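(* The mapping $(u,\mu)\mapsto(\tilde{\mathsf w},\tilde\upsilon)$, where $$\tilde{\mathsf w}(x)=-\frac{u(\log x)+u'(\log x)}{x}\quad\text{for almost every }x>0$$ and $\tilde\upsilon$ is the positive Borel measure on $[0,\infty)$ with $\tilde\upsilon(\{0\})=0$ and $$\tilde\upsilon(B)=\int_{\log(B)}e^{-x}d\upsilon(x)\quad\text{for every Borel set }B\subseteq(0,\infty),$$ is a bijection between $\mathcal{D}$ and $\mathcal{S}_0$.
   Context: For a Borel measure $\nu$, $\int_x^y f\,d\nu$ with $x<y$ denotes the integral over $[x,y)$ (and $\int_{-\infty}^y$ the one over $(-\infty,y)$, $\int_x^\infty$ the one over $[x,\infty)$). $H^1_{\mathrm{loc}}(\mathbb{R})$ is the space of locally absolutely continuous functions on $\mathbb{R}$ with derivative in $L^2_{\mathrm{loc}}(\mathbb{R})$. $\mathcal{D}$ is the set of all pairs $(u,\mu)$ where $u\in H^1_{\mathrm{loc}}(\mathbb{R})$ is real-valued and $\mu$ is a positive Borel measure on $\mathbb{R}$ with $\int_B u^2+u'^2\,dx\le\mu(B)$ for every Borel set $B\subseteq\mathbb{R}$, such that, with the positive Borel measure $\upsilon$ defined by $\mu(B)=\upsilon(B)+\int_B u(x)^2+u'(x)^2\,dx$, $$\int_{-\infty}^0 e^{-s}(u(s)^2+u'(s)^2)\,ds+\int_{-\infty}^0e^{-s}d\upsilon(s)<\infty,$$ $$\limsup_{x\to\infty}e^{x}\Bigl(\int_x^\infty e^{-s}(u(s)+u'(s))^2ds+\int_x^\infty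 e^{-s}d\upsilon(s)\Bigr)<\infty.$$ $\mathcal{S}_0$ is the set of all pairs $(\tilde{\mathsf w},\tilde\upsilon)$ such that $\tilde{\mathsf w}$ is an almost everywhere real-valued function in $L^2(0,\infty)$, $\tilde\upsilon$ is a finite positive Borel measure on $[0,\infty)$ with no point mass at zero, and $$\limsup_{x\to\infty}\;x\int_x^\infty\tilde{\mathsf w}(s)^2ds+x\int_x^\infty d\tilde\upsilon<\infty.$$ (Functions in $L^2(0,\infty)$ are identified when equal almost everywhere.)
   Formalization: The measure μ in 𝒟 is additionally required to be finite on compact sets; without this u=0, μ=∞·δ₁ lies in 𝒟 but its image is not a finite measure, so the map would not land in 𝒮₀. *)

(* Defs.v *)
From HB Require Import structures.
From mathcomp Require Import all_boot all_order all_algebra.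
From mathcomp Require Import all_classical all_reals all_analysis.

Set Implicit Arguments.
Unset Strict Implicit.
Unset Printing Implicit Defensive.

Import Order.TTheory GRing.Theory Num.Theory.
Import numFieldNormedType.Exports.

Local Open Scope classical_set_scope.
Local Open Scope ring_scope.

(* A [{measure set _ -> \bar R}] also assigns (irrelevant) values to
   non-measurable sets, so equality of measures is [eq_borel], not [=]. *)
Definition borel_measure (R : realType) : Type :=
  {measure set (measurableTypeR R) -> \bar R}.

Definition eq_borel (R : realType) (m1 m2 : borel_measure R) : Prop :=
  forall B : set (measurableTypeR R), measurable B -> m1 B = m2 B.

Definition locally_finite (R : realType) (m : borel_measure R) : Prop :=
  forall K : set R, compact K -> (m K < +oo)%E.

Definition absolutely_continuous (R : realType) (a b : R) (f : R -> R) : Prop :=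
  forall e : R, 0 < e -> exists2 d : R, 0 < d &
    forall (n : nat) (x y : 'I_n -> R),
      (forall i, a <= x i /\ x i <= y i /\ y i <= b) ->
      trivIset setT (fun i => `]x i, y i[%classic) ->
      \sum_(i < n) (y i - x i) < d ->
      \sum_(i < n) `|f (y i) - f (x i)| < e.

Definition loc_absolutely_continuous (R : realType) (f : R -> R) : Prop :=
  forall a b : R, a < b -> absolutely_continuous a b f.

Definition L2loc (R : realType) (f : R -> R) : Prop :=
  measurable_fun [set: R] f /\
  forall K : set R, compact K ->
    (\int[lebesgue_measure]_(x in K) (f x ^+ 2)%:E < +oo)%E.

(* [derive1 u x] is the derivative of [u] at the points of differentiability, hence
   almost everywhere when [u] is locally absolutely continuous, and a default
   value elsewhere. *)
Definition H1loc (R : realType) (u : R -> R) : Prop :=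
  loc_absolutely_continuous u /\ L2loc (derive1 u).

Definition energy (R : realType) (u : R -> R) (B : set R) : \bar R :=
  (\int[lebesgue_measure]_(x in B) (u x ^+ 2 + derive1 u x ^+ 2)%:E)%E.

(* [ups] is the measure $\upsilon$ of the pair $(u, \mu)$; it is unique up to
   [eq_borel] when [u] is in [H1loc], because the energy is then finite on
   bounded sets. *)
Definition is_upsilon (R : realType) (u : R -> R) (mu ups : borel_measure R) :
    Prop :=
  forall B : set (measurableTypeR R), measurable B ->
    (mu B = ups B + energy u B)%E.

Definition set_D (R : realType) : set ((R -> R) * borel_measure R) :=
  [set p | let: (u, mu) := p in
    [/\ H1loc u,
        locally_finite mu,
        forall B : set (measurableTypeR R), measurable B ->
          (energy u B <= mu B)%E
      & exists ups : borel_measure R,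
        [/\ is_upsilon u mu ups,
            (\int[lebesgue_measure]_(s in `]-oo, 0%R[)
                 (expR (- s) * (u s ^+ 2 + derive1 u s ^+ 2))%:E
             + \int[ups]_(s in `]-oo, 0%R[) (expR (- s))%:E < +oo)%E
          & (limf_esup (fun x : R => (expR x)%:E *
                (\int[lebesgue_measure]_(s in `[x, +oo[)
                     (expR (- s) * (u s + derive1 u s) ^+ 2)%:E
                 + \int[ups]_(s in `[x, +oo[) (expR (- s))%:E))
               (pinfty_nbhs R) < +oo)%E]]].

(* A function on $(0,\infty)$ is given by a function on the line, considered
   only on `]0, +oo[. *)
Definition L2_pos (R : realType) (w : R -> R) : Prop :=
  measurable_fun (`]0%R, +oo[%classic : set R) w /\
  (\int[lebesgue_measure]_(x in `]0%R, +oo[) (w x ^+ 2)%:E < +oo)%E.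

(* A Borel measure on $[0,\infty)$ is given by its extension by zero to the
   line. *)
Definition on_nonneg (R : realType) (m : borel_measure R) : Prop :=
  m (`]-oo, 0%R[%classic : set R) = 0%E.

Definition set_S0 (R : realType) : set ((R -> R) * borel_measure R) :=
  [set q | let: (w, nu) := q in
    [/\ L2_pos w,
        on_nonneg nu,
        (nu [set: R] < +oo)%E,
        nu [set (0 : R)] = 0%E
      & (limf_esup (fun x : R =>
             x%:E * \int[lebesgue_measure]_(s in `[x, +oo[) (w s ^+ 2)%:E
             + x%:E * nu (`[x, +oo[%classic : set R))
           (pinfty_nbhs R) < +oo)%E]].

Definition eq_D (R : realType) (p p' : (R -> R) * borel_measure R) : Prop :=
  p.1 = p'.1 /\ eq_borel p.2 p'.2.

Definition eq_S0 (R : realType) (q q' : (R -> R) * borel_measure R) : Prop :=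
  ae_eq lebesgue_measure (`]0%R, +oo[%classic : set R) q.1 q'.1 /\
  eq_borel q.2 q'.2.

(* The graph of the mapping $(u, \mu) \mapsto (w, \nu)$. *)
Definition transform (R : realType) (p q : (R -> R) * borel_measure R) : Prop :=
  let: (u, mu) := p in let: (w, nu) := q in
  [/\ ae_eq lebesgue_measure (`]0%R, +oo[%classic : set R) w
        (fun x => - ((u (ln x) + derive1 u (ln x)) / x)),
      on_nonneg nu,
      nu [set (0 : R)] = 0%E
    & exists2 ups : borel_measure R, is_upsilon u mu ups &
      forall B : set (measurableTypeR R), measurable B ->
        B `<=` `]0%R, +oo[%classic ->
        (nu B = \int[ups]_(x in (@ln R) @` B) (expR (- x))%:E)%E].

(* [T] is the graph of a map which induces a bijection from [X] modulo [eqA]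
   onto [Y] modulo [eqB]: it is total with values in [Y], well defined,
   injective and surjective. *)
Definition bijection_mod (A B : Type) (eqA : A -> A -> Prop)
    (eqB : B -> B -> Prop) (X : set A) (Y : set B) (T : A -> B -> Prop) : Prop :=
  [/\ forall a, X a -> exists2 b, Y b & T a b,
      forall a a' b b', X a -> X a' -> T a b -> T a' b' ->
        eqA a a' -> eqB b b',
      forall a a' b b', X a -> X a' -> T a b -> T a' b' ->
        eqB b b' -> eqA a a'
    & forall b, Y b -> exists2 a, X a & T a b].

(* Main.v *)
(** Write [f = u + u'].  In the variable [y = exp x] the map reads
    [w y = - f (ln y) / y], and [exp] pushes [exp x dx] forward to the Lebesgue
    measure of the positive half-line, so that [w ^ 2 dy] corresponds to
    [exp (- s) * f s ^ 2 ds] and the conditions at infinity on both sides agree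
    literally.  It remains to see that [u] is determined by [f].  Two candidates
    differ by [c * exp (- x)], and the integrability at [-oo] forces [c = 0].
    Conversely [u x = exp (- x) * \int_(-oo)^x exp s * f s ds] solves
    [u + u' = f], and integrating
    [exp (- s) (u + u') ^ 2 = exp (- s) (2 u ^ 2 + u' ^ 2) + (exp (- s) u ^ 2)']
    over [(a, 0)], where [exp (- a) u a ^ 2] is bounded by weighted AM-GM,
    gives the integrability at [-oo].

    Both directions need the fundamental theorem of calculus for absolutely
    continuous functions: the variation function is again absolutely continuous,
    so its Lebesgue-Stieltjes measure has a Radon-Nikodym density, and Lebesgue's
    differentiation theorem applies to that density. *)

Require Import Defs.
From HB Require Import structures.
From mathcomp Require Import all_boot all_order all_algebra.
From mathcomp Require Import all_classical all_reals all_analysis.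
From mathcomp Require Import measurable_realfun.
From mathcomp Require Import ring lra.

Set Implicit Arguments.
Unset Strict Implicit.
Unset Printing Implicit Defensive.
Import Order.TTheory GRing.Theory Num.Theory.
Import numFieldNormedType.Exports.
Local Open Scope classical_set_scope.
Local Open Scope ring_scope.

(** * Absolutely continuous functions *)

(** The measure component is handled separately from [u]. [nu] is the image of [ups] under [expR]
    with density [expR (- x)], and [ups] is the image of [nu] under [ln] with density [y]. Each
    density undoes the other, so the two measures determine each other; the second component of the
    pair is then [ups] plus the energy of [u]. The growth conditions in [set_D] control only the
    left half-line and a ray far to the right. On the bounded interval between them, finiteness
    comes from local finiteness and [H1loc]; together these pieces make [w] square integrable and
    [nu] finite. Conversely, finiteness of [nu] makes [ups] locally finite. In the surjectivity part
    the boundary term at [a] stays bounded because [u] grows at most like [expR (x / 2)], the rate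
    that Cauchy-Schwarz would give. Membership of this [u] in [H1loc] concerns [derive1 u] as an
    everywhere defined function, so its Borel measurability is a separate matter, settled for every
    continuous function. *)

Section absolute_continuity.
Context {R : realType}.
Implicit Types (a b : R) (f g : R -> R).

(** Refining each interval of a family by a partition produces a family indexed by pairs, whereas
    the definition counts intervals by ['I_n]; [enum_val] reindexes. *)
Lemma ac_finType a b f (e : R) : absolutely_continuous a b f -> 0 < e ->
  exists2 d : R, 0 < d & forall (T : finType) (x y : T -> R),
    (forall t, a <= x t /\ x t <= y t /\ y t <= b) ->
    trivIset setT (fun t => `]x t, y t[%classic) ->
    \sum_t (y t - x t) < d -> \sum_t `|f (y t) - f (x t)| < e.
Proof.
move=> fac e0; have [d d0 fd] := fac e e0; exists d => // T x y xy txy xyd.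
have bij : {on [pred i : T | true], bijective (@enum_val T (mem T))}.
  exact: onW_bij (enum_val_bij T).
rewrite (reindex _ bij)/=; apply: (fd #|T| (x \o enum_val) (y \o enum_val)).
- by move=> i; exact: xy.
- move=> i j _ _ /= ij; exact/enum_val_inj/txy.
- by move: xyd; rewrite (reindex _ bij).
Qed.

(** The default [b] of [nth] is the right endpoint, so monotonicity persists for indices beyond the
    partition. *)
Lemma itv_partition_nth_homo a b s k l : itv_partition a b s -> (k <= l)%N ->
  nth b (a :: s) k <= nth b (a :: s) l.
Proof.
move=> abs kl; have [ls|ls] := ltnP l (size s).+1; last first.
  have [ks|ks] := ltnP k (size s).+1; last by rewrite !nth_default.
  by rewrite [leRHS]nth_default// itv_partition_nth_le.
case: abs => sas _.
have ss : sorted <=%R (a :: s) by move: sas; apply: sub_path => u v /ltW.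
by apply: (le_sorted_leq_nth b ss) => //; rewrite inE (leq_ltn_trans kl).
Qed.

Lemma variation_pad a b f s M : itv_partition a b s -> (size s <= M)%N ->
  variation a b f s =
  \sum_(k < M) `|f (nth b (a :: s) k.+1) - f (nth b (a :: s) k)|.
Proof.
move=> abs sM.
rewrite /variation -(big_mkord xpredT (fun k =>
  `|f (nth b (a :: s) k.+1) - f (nth b (a :: s) k)|)).
rewrite (@big_cat_nat _ _ _ (size s) 0 M)//=.
rewrite [X in _ = _ + X]big_nat [X in _ = _ + X]big1 ?addr0//.
move=> k /andP[sk _]; rewrite !(nth_default _ sk).
(* At [k = size s] the left point is the last point of the partition, which is [b]; beyond that it
   is the default [b]. *)
rewrite (_ : nth b (a :: s) k = b) ?subrr ?normr0//.
move: sk; rewrite leq_eqVlt => /predU1P[<-|sk]; last by rewrite nth_default.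
exact: itv_partition_nth_size abs.
Qed.

(* Padding the partitions to a common length, with empty intervals, turns their
   union into one family indexed by ['I_n * 'I_M]. *)
Lemma ac_variations a b f (e : R) : absolutely_continuous a b f -> 0 < e ->
  exists2 d : R, 0 < d & forall n (x y : 'I_n -> R) (s : 'I_n -> seq R),
    (forall i, a <= x i /\ x i <= y i /\ y i <= b) ->
    trivIset setT (fun i => `]x i, y i[%classic) ->
    \sum_(i < n) (y i - x i) < d ->
    (forall i, itv_partition (x i) (y i) (s i)) ->
    \sum_(i < n) variation (x i) (y i) f (s i) < e.
Proof.
move=> fac e0; have [d d0 fd] := ac_finType fac e0.
exists d => // n x y s xy txy xyd sxy.
pose M := (\max_(i < n) size (s i))%N.
pose p i k := nth (y i) (x i :: s i) k.
have sM i : (size (s i) <= M)%N by exact: leq_bigmax.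
under eq_bigr do rewrite (variation_pad _ (sxy _) (sM _)).
rewrite pair_big/=.
apply: (fd _ (fun t : 'I_n * 'I_M => p t.1 t.2) (fun t => p t.1 t.2.+1)).
- move=> [i k] /=; have [axi [_ yib]] := xy i.
  have h0 l : x i <= p i l by exact: (itv_partition_nth_homo (sxy i) (leq0n l)).
  have h1 l : p i l <= y i.
    have [ls|ls] := ltnP l (size (s i)).+1; first exact: itv_partition_nth_le.
    by rewrite /p nth_default.
  by rewrite (le_trans axi (h0 _)) (le_trans (h1 _) yib)
     (itv_partition_nth_homo (sxy i)).
- move=> [i k] [j l] _ _ /= [z []] /=; rewrite !in_itv/= => /andP[z1 z2] /andP[z3 z4].
  have bd i' (l' : nat) : x i' <= p i' l' <= y i'.
    apply/andP; split; first exact: (itv_partition_nth_homo (sxy i') (leq0n l')).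
    have [ls|ls] := ltnP l' (size (s i')).+1; first exact: itv_partition_nth_le.
    by rewrite /p nth_default.
  have ij : i = j.
    apply: txy => //; exists z; split; rewrite /= in_itv/=.
      have /andP[h _] := bd i k; have /andP[_ h'] := bd i k.+1.
      by rewrite (le_lt_trans h z1) (lt_le_trans z2 h').
    have /andP[h _] := bd j l; have /andP[_ h'] := bd j l.+1.
    by rewrite (le_lt_trans h z3) (lt_le_trans z4 h').
  subst j; congr (_, _); apply/val_inj/eqP => /=.
  have [kl|kl|//] := ltngtP (k : nat) l.
    have := itv_partition_nth_homo (sxy i) kl.
    by move=> /(lt_le_trans z2)/(lt_trans z3); rewrite ltxx.
  have := itv_partition_nth_homo (sxy i) kl.
  by move=> /(lt_le_trans z4)/(lt_trans z1); rewrite ltxx.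
- rewrite -(pair_big xpredT xpredT (fun i (k : 'I_M) => p i k.+1 - p i k))/=.
  rewrite (le_lt_trans _ xyd)//; apply: ler_sum => i _.
  rewrite -(big_mkord xpredT (fun k => p i k.+1 - p i k)) telescope_sumr//.
  rewrite lerB//; have [ls|ls] := ltnP M (size (s i)).+1.
    exact: itv_partition_nth_le.
  by rewrite /p nth_default.
Qed.

(** Partitions that come within [r / n.+1] of each of the [n] suprema reduce this to
    [ac_variations]; passing to the supremum weakens [<] to [<=]. *)
Lemma ac_total_variation a b f (e : R) : absolutely_continuous a b f -> 0 < e ->
  exists2 d : R, 0 < d & forall n (x y : 'I_n -> R),
    (forall i, a <= x i /\ x i <= y i /\ y i <= b) ->
    trivIset setT (fun i => `]x i, y i[%classic) ->
    \sum_(i < n) (y i - x i) < d ->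
    (\sum_(i < n) total_variation (x i) (y i) f <= e%:E)%E.
Proof.
move=> fac e0; have [d d0 fd] := ac_variations fac e0.
exists d => // n x y xy txy xyd.
have xle i : x i <= y i by have [_ []] := xy i.
have parts i : exists s, itv_partition (x i) (y i) s.
  have := xle i; rewrite le_eqVlt => /predU1P[->|].
    by exists [::]; split => //=.
  by exists [:: y i]; exact: itv_partition1.
have [s0 s0P] := choice parts.
(* Near-optimal partitions exist only once the suprema are finite. For this the partition of one
   interval varies while the others keep an arbitrary [s0]. *)
have tvfin i : total_variation (x i) (y i) f \is a fin_num.
  rewrite ge0_fin_numE ?total_variation_ge0//.
  apply: (@le_lt_trans _ _ e%:E); last exact: ltry.
  apply: ge_ereal_sup => _ [_ [s sP <-] <-]; rewrite lee_fin.
  have := fd n x y (fun j => if j == i then s else s0 j) xy txy xyd.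
  move=> /(_ _)/ltW; rewrite (bigD1 i)//= eqxx => H.
  apply: le_trans (H _); last by move=> j; case: eqVneq => [->|].
  by rewrite lerDl sumr_ge0// => j _; exact: variation_ge0.
apply/lee_addgt0Pr => r r0.
pose q := r / n.+1%:R.
have q0 : 0 < q by rewrite divr_gt0.
have ex i : exists s, itv_partition (x i) (y i) s /\
    (total_variation (x i) (y i) f <= (variation (x i) (y i) f s)%:E + q%:E)%E.
  have [_ [_ [s sP <-] <-]] := ub_ereal_sup_adherent q0 (tvfin i).
  by rewrite lteBlDr// => /ltW; exists s.
have [s sP] := choice ex.
apply: (@le_trans _ _ (\sum_(i < n)
    ((variation (x i) (y i) f (s i))%:E + q%:E))%E).
  by apply: lee_sum => i _; exact: (sP i).2.
rewrite big_split/= leeD//.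
  by rewrite sumEFin lee_fin ltW// fd// => i; have [] := sP i.
rewrite sumEFin lee_fin sumr_const card_ord -mulr_natr /q mulrAC -mulrA.
rewrite ler_piMr ?(ltW r0)//.
by rewrite ler_pdivrMr// mul1r ler_nat.
Qed.

End absolute_continuity.

(** * Closure properties and the variation function *)

Section absolute_continuity_closure.
Context {R : realType}.
Implicit Types (a b : R) (f g : R -> R).

(** A domination criterion that covers products, differences and the exponentials alike. *)
Lemma ac_le (a b C : R) (f g F : R -> R) : 0 <= C ->
  (forall x y, a <= x -> x <= y -> y <= b ->
     `|F y - F x| <= C * (`|f y - f x| + `|g y - g x|)) ->
  absolutely_continuous a b f -> absolutely_continuous a b g ->
  absolutely_continuous a b F.
Proof.
move=> C0 FC fac gac e e0.
(* [C + 1] in place of [C] keeps the quotient meaningful when [C = 0]. *)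
have k0 : 0 < e / (2 * (C + 1)) by rewrite divr_gt0// mulr_gt0// ltr_wpDl.
have [d1 d10 f1] := fac _ k0; have [d2 d20 g2] := gac _ k0.
exists (Num.min d1 d2); first by rewrite lt_min d10.
move=> n x y xy txy; rewrite lt_min => /andP[xy1 xy2].
apply: (@le_lt_trans _ _ (C * (\sum_(i < n) `|f (y i) - f (x i)| +
                              \sum_(i < n) `|g (y i) - g (x i)|))).
  rewrite -big_split mulr_sumr; apply: ler_sum => i _ /=.
  by have [? []] := xy i; exact: FC.
have h1 := f1 n x y xy txy xy1; have h2 := g2 n x y xy txy xy2.
apply: (@le_lt_trans _ _ (C * (e / (C + 1)))).
  rewrite ler_wpM2l// ltW//; apply: lt_le_trans (ltrD h1 h2) _.
  rewrite [leLHS](_ : _ = e / (C + 1))//.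
  by field; rewrite gt_eqF// ltr_wpDl.
rewrite mulrCA gtr_pMr// ltr_pdivrMr ?mul1r ?ltrDl//.
by rewrite ltr_wpDl.
Qed.

Lemma ac_id a b : absolutely_continuous a b (@idfun R).
Proof.
move=> e e0; exists e => // n x y xy _ xyd.
rewrite (le_lt_trans _ xyd)//; apply: ler_sum => i _ /=.
by have [_ [? _]] := xy i; rewrite ger0_norm// subr_ge0.
Qed.

Lemma ac_unif_continuous a b f (e : R) : absolutely_continuous a b f -> 0 < e ->
  exists2 d : R, 0 < d & forall x y, a <= x -> x <= y -> y <= b -> y - x < d ->
    `|f y - f x| < e.
Proof.
move=> fac e0; have [d d0 fd] := fac e e0; exists d => // x y ax xy yb xyd.
have := fd 1%N (fun=> x) (fun=> y).
rewrite !big_ord1; apply => //.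
by move=> i j _ _ _; rewrite (ord1 i) (ord1 j).
Qed.

Lemma ac_continuous_within a b f : absolutely_continuous a b f ->
  {within `[a, b], continuous f}.
Proof.
move=> fac; apply/subspace_continuousP => x /=; rewrite in_itv/= => /andP[ax xb].
apply/cvgrPdist_lt => /= e e0.
have [d d0 fd] := ac_unif_continuous fac e0.
apply/nbhs_ballP; exists d => // y; rewrite /ball/= => xyd.
rewrite in_itv/= => /andP[ay yb].
have [xy|yx] := leP x y.
  by rewrite distrC fd// -(ger0_norm (_ : 0 <= y - x)) ?subr_ge0// distrC.
by rewrite fd// ?(ltW yx)// -(ger0_norm (_ : 0 <= x - y)) ?subr_ge0// ltW.
Qed.

Lemma ac_bounded a b f : absolutely_continuous a b f ->
  exists2 M : R, 0 < M & forall x, a <= x -> x <= b -> `|f x| <= M.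
Proof.
move=> fac.
have := @segment_compact R a b.
move=> /(continuous_compact (ac_continuous_within fac))/compact_bounded.
move=> [M [_ MB]]; exists (`|M| + 1); first by rewrite ltr_wpDl.
move=> x ax xb; apply: MB; first by rewrite ltr_pwDr// ler_norm.
by exists x => //=; rewrite in_itv/= ax.
Qed.

Lemma acM a b f g : absolutely_continuous a b f -> absolutely_continuous a b g ->
  absolutely_continuous a b (fun x => f x * g x).
Proof.
move=> fac gac.
have [M M0 fM] := ac_bounded fac; have [N N0 gN] := ac_bounded gac.
apply: (@ac_le a b (M + N) f g) => //; first by rewrite addr_ge0// ltW.
move=> x y ax xy yb.
rewrite (_ : _ - _ = f y * (g y - g x) + (f y - f x) * g x); last by ring.
rewrite (le_trans (ler_normD _ _))// !normrM.
have h1 := fM y (le_trans ax xy) yb; have h2 := gN x ax (le_trans xy yb).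
have p1 := normr_ge0 (f y); have p2 := normr_ge0 (g x).
have p3 := normr_ge0 (g y - g x); have p4 := normr_ge0 (f y - f x).
have q1 := ler_wpM2r p3 h1; have q2 := ler_wpM2l p4 h2.
have q3 := mulr_ge0 (ltW M0) p4; have q4 := mulr_ge0 (ltW N0) p3.
by lra.
Qed.

Lemma acB a b f g : absolutely_continuous a b f -> absolutely_continuous a b g ->
  absolutely_continuous a b (fun x => f x - g x).
Proof.
move=> fac gac; apply: (@ac_le a b 1 f g) => // x y _ _ _; rewrite mul1r.
rewrite (_ : _ - _ = (f y - f x) - (g y - g x)); last by ring.
exact: ler_normB.
Qed.

(** Intervals shorter than [d] carry variation at most 1, and finitely many steps of length [d / 2]
    exhaust [[a, b]]; the induction is on the number of steps. *)
Lemma ac_bounded_variation a b f : a <= b -> absolutely_continuous a b f ->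
  bounded_variation a b f.
Proof.
move=> ab fac; apply/(bounded_variationP _ ab).
have [d d0 fd] := ac_total_variation fac (@ltr01 R).
have {}fd x y : a <= x -> x <= y -> y <= b -> y - x < d ->
    (total_variation x y f <= 1)%E.
  move=> ax xy yb xyd; have := fd 1%N (fun=> x) (fun=> y).
  rewrite !big_ord1; apply => //.
  by move=> i j _ _ _; rewrite (ord1 i) (ord1 j).
have H k : forall c, a <= c -> c <= b -> c - a <= k%:R * (d / 2) ->
    total_variation a c f \is a fin_num.
  elim: k => [|k ih] c ac cb cad.
    have -> : c = a.
      apply/eqP; rewrite eq_le ac andbT.
      by move: cad; rewrite mul0r subr_le0.
    by rewrite total_variationxx.
  pose c' := Num.max a (c - d / 2).
  have ac' : a <= c' by rewrite le_max lexx.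
  have c'c : c' <= c by rewrite ge_max ac/= gerBl divr_ge0// ltW.
  have c'd : c' - a <= k%:R * (d / 2).
    have k0 : 0 <= k%:R * (d / 2) by rewrite mulr_ge0// divr_ge0// ltW.
    move: cad; rewrite -natr1 mulrDl mul1r /c'.
    by case: (leP a (c - d / 2)) => _; lra.
  have cc'd : c - c' < d by rewrite /c'; case: (leP a (c - d / 2)) => ?; lra.
  rewrite (total_variationD f ac' c'c) fin_numD; apply/andP; split.
    exact: ih (le_trans c'c cb) c'd.
  by rewrite ge0_fin_numE ?total_variation_ge0// (@le_lt_trans _ _ 1%E) ?ltry// fd.
apply: (H (Num.truncn ((b - a) / (d / 2))).+1) => //.
rewrite -ler_pdivrMr ?divr_gt0//.
by rewrite ltW// truncnS_gt.
Qed.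

(** By additivity the increments of the variation function are the variations over the subintervals.
    The bound [e / 2] restores the strict inequality lost in [ac_total_variation]. *)
Lemma ac_fine_total_variation a b f : a <= b -> absolutely_continuous a b f ->
  absolutely_continuous a b (fun x => fine (total_variation a x f)).
Proof.
move=> ab fac e e0.
have e20 : 0 < e / 2 by rewrite divr_gt0.
have [d d0 fd] := ac_total_variation fac e20.
have bv := ac_bounded_variation ab fac.
have tvfin x y : a <= x -> x <= y -> y <= b -> total_variation x y f \is a fin_num.
  move=> ax xy yb; apply/(bounded_variationP _ xy).
  apply: (bounded_variationr ax xy).
  exact: bounded_variationl (le_trans ax xy) yb bv.
exists d => // n x y xy txy xyd.
rewrite -lte_fin -sumEFin.
apply: (@le_lt_trans _ _ (e / 2)%:E); last first.
  by rewrite lte_fin ltr_pdivrMr// ltr_pMr// ltr1n.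
apply: le_trans (fd n x y xy txy xyd).
apply: lee_sum => i _; have [ax [xiy yb]] := xy i.
rewrite (total_variationD f ax xiy) fineD ?tvfin// ?(le_trans _ yb)//.
rewrite [X in `|X|%:E](_ : _ = fine (total_variation (x i) (y i) f)); last by ring.
by rewrite ger0_norm ?fine_ge0 ?total_variation_ge0// fineK ?tvfin.
Qed.

End absolute_continuity_closure.

(** * Absolute continuity of Lebesgue-Stieltjes measures *)

Section lebesgue_stieltjes_density.
Context {R : realType}.
Notation mu := (@lebesgue_measure R).
Local Open Scope ereal_scope.

(** Finite measure excludes rays and the line; the empty set is written []0, 0[]. This supplies
    endpoints for the components of an open set. *)
Lemma open_interval_bnd (I : set R) : open I -> is_interval I -> mu I < +oo ->
  exists x y, (x <= y)%R /\ I = `]x, y[%classic.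
Proof.
move=> oI iI; rewrite (is_intervalP I).1//; move: oI; rewrite {1}(is_intervalP I).1//.
case: (Rhull I) => i1 i2 oI.
have e0 : exists x y : R, (x <= y)%R /\ set0 = `]x, y[%classic.
  by exists 0%R, 0%R; rewrite lexx set_itvoo0.
have oE : [set` Interval i1 i2]%classic = [set` Interval i1 i2]°%classic.
  exact/esym/interior_id.
rewrite lebesgue_measure_itv /= {oI}oE.
case: i1 => [b1 x|[]]; case: i2 => [b2 y|[]] /=.
all: try by rewrite set_itvE interior0.
all: try by rewrite ?ltry ?ltNyr.
rewrite interior_itv_bnd lte_fin.
have [xy _|yx _] := ltP x y; first by exists x, y; split => //; exact: ltW.
by rewrite set_itv_ge// bnd_simp -leNgt.
Qed.

Lemma lebesgue_stieltjes_oc (F : cumulative R R) x y : (x <= y)%R ->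
  lebesgue_stieltjes_measure F `]x, y]%classic = (F y - F x)%:E.
Proof.
move=> xy.
rewrite /lebesgue_stieltjes_measure /measure_extension.
rewrite measurable_mu_extE/=; last exact: is_ocitv.
by rewrite wlength_itv_bnd.
Qed.

(* Absolute continuity on the whole line, with a modulus [d] that does not depend
   on a bounded interval. *)
Definition interval_continuous (F : R -> R) := forall e : R, (0 < e)%R ->
  exists2 d : R, (0 < d)%R & forall n (x y : 'I_n -> R),
    (forall i, x i <= y i)%R ->
    trivIset setT (fun i => `]x i, y i[%classic) ->
    (\sum_(i < n) (y i - x i) < d)%R ->
    (\sum_(i < n) `|F (y i) - F (x i)| < e)%R.

(** A null set lies in an open set of Lebesgue measure below [d], whose components are disjoint open
    intervals. The Stieltjes measure of their union is the limit of sums over finitely many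
    components, each at most [e]. *)
Lemma lebesgue_stieltjes_dominated (F : cumulative R R) :
  interval_continuous F -> lebesgue_stieltjes_measure F `<< mu.
Proof.
move=> Fac; apply/null_content_dominatesP => A mA A0.
apply/eqP; rewrite eq_le measure_ge0 andbT; apply/lee_addgt0Pr => e e0.
rewrite add0e; have [d d0 Fd] := Fac e e0.
have [|U [oU AU Ud]] := @lebesgue_regularity_outer R A d mA _ d0.
  by rewrite A0.
have {}Ud : mu U < d%:E.
  apply: le_lt_trans Ud; rewrite -{1}(setDUK AU).
  by rewrite (le_trans (measureU2 _ _ _))//= ?A0 ?add0e//;
    apply: measurableD => //; exact: open_measurable.
have mU : measurable U by exact: open_measurable.
apply: (@le_trans _ _ (lebesgue_stieltjes_measure F U)).
  by rewrite le_measure// inE.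
pose I := open_disjoint_itv oU.
have mI k : measurable (I k) by apply: open_measurable; exact: open_disjoint_itv_open.
have Ilt k : mu (I k) < +oo.
  apply: (@le_lt_trans _ _ (mu U)); last exact: lt_trans Ud (ltry _).
  apply: le_measure; rewrite ?inE; [exact: mI|exact: mU|].
  by move=> x Ix; rewrite (open_disjoint_itv_bigcup oU); exists k.
have /choice[xy Ixy] k :
    exists xy : R * R, (xy.1 <= xy.2)%R /\ I k = `]xy.1, xy.2[%classic.
  have [||x [y [? ?]]] := @open_interval_bnd (I k) _ _ (Ilt k).
  - exact: open_disjoint_itv_open.
  - exact: open_disjoint_itv_is_interval.
  - by exists (x, y).
have tI : trivIset [set: nat] I by exact: open_disjoint_itv_trivIset.
rewrite (open_disjoint_itv_bigcup oU) measure_bigcup//; last by move=> i _; exact: mI.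
apply: lime_le; first by apply: is_cvg_nneseries => *; exact: measure_ge0.
apply: nearW => n.
apply: (@le_trans _ _ (\sum_(i < n) (F (xy i).2 - F (xy i).1)%:E)).
  rewrite big_mkcond big_mkord; apply: lee_sum => i _.
  rewrite in_setT -/I (Ixy i).2 -lebesgue_stieltjes_oc ?(Ixy i).1//.
  by rewrite le_measure ?inE//; exact: subset_itv_oo_oc.
rewrite sumEFin lee_fin; apply/ltW.
apply: (@le_lt_trans _ _ (\sum_(i < n) `|F (xy i).2 - F (xy i).1|)%R).
  by apply: ler_sum => i _; exact: ler_norm.
apply: (Fd n (fun i => (xy i).1) (fun i => (xy i).2)).
- by move=> i; exact: (Ixy i).1.
- move=> i j _ _ ij; apply/val_inj/tI => //.
  by rewrite !(Ixy _).2.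
- rewrite -lte_fin -sumEFin; apply: le_lt_trans Ud.
  apply: (@le_trans _ _ (\sum_(i < n) mu (I i))).
    apply: lee_sum => i _; rewrite (Ixy i).2 lebesgue_measure_itv/= lte_fin.
    case: ltP => [//|h]; rewrite lee_fin subr_le0//.
  rewrite (_ : (\sum_(i < n) _)%E = mu (\big[setU/set0]_(i < n) I i)); last first.
    by apply/esym/measure_bigsetU; [move=> k; exact: mI|exact: tI].
  apply: le_measure; rewrite ?inE.
  - by apply: bigsetU_measurable => i _; exact: mI.
  - exact: mU.
  - by rewrite (open_disjoint_itv_bigcup oU) -bigcup_mkord; apply: bigcup_subset.
Qed.

End lebesgue_stieltjes_density.

(** * Monotone absolutely continuous functions as primitives *)

Section absolute_continuity_primitive.
Context {R : realType}.
Notation mu := (@lebesgue_measure R).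
Implicit Types (a b : R) (f g F : R -> R).

(** For [a <= b], the retraction of the line onto [[a, b]]; composing with it extends a function
    from [[a, b]] by constants. *)
Definition clamp a b (x : R) : R := Num.max a (Num.min b x).

Lemma clampE a b x : a <= x -> x <= b -> clamp a b x = x.
Proof. by move=> ax xb; rewrite /clamp (min_idPr xb) (max_idPr ax). Qed.

Lemma clamp_ge a b x : a <= clamp a b x. Proof. by rewrite le_max lexx. Qed.

Lemma clamp_le a b x : a <= b -> clamp a b x <= b.
Proof. by move=> ab; rewrite ge_max ab ge_min lexx. Qed.

Lemma clamp_homo a b : {homo clamp a b : x y / x <= y}.
Proof. by move=> x y xy; rewrite le_max2// le_min2. Qed.

Lemma clamp_dist a b x y : x <= y -> clamp a b y - clamp a b x <= y - x.
Proof.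
rewrite /clamp => xy.
have h : Num.min b y - Num.min b x <= y - x.
  by case: (leP b x) => ?; case: (leP b y) => ?; lra.
by case: (leP a (Num.min b x)) => ?; case: (leP a (Num.min b y)) => ?; lra.
Qed.

Lemma ac_clamp a b F : a <= b -> absolutely_continuous a b F ->
  interval_continuous (F \o clamp a b).
Proof.
move=> ab Fac e e0; have [d d0 Fd] := Fac e e0; exists d => // n x y xy txy xyd.
apply: (Fd n (clamp a b \o x) (clamp a b \o y)).
- by move=> i /=; rewrite clamp_ge clamp_homo// clamp_le.
- move=> i j _ _ [z /= []]; rewrite !in_itv/= => /andP[z1 z2] /andP[z3 z4].
  apply: txy => //; exists z; rewrite /= !in_itv/=.
  (* A point strictly between two clamped endpoints lies in []a, b[], where clamping changes
     nothing, so it already lies in the original interval. *)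
  move: z1 z2 z3 z4; rewrite /clamp !gt_max !lt_max.
  move=> /andP[az z1] /orP[|z2 /andP[_ z3] /orP[|z4]].
    by rewrite ltNge (ltW az).
    by rewrite ltNge (ltW az).
  move: z2 z4; rewrite !lt_min => /andP[zb z2] /andP[_ z4].
  move: z1 z3; rewrite !gt_min => /orP[bz|z1]; first by rewrite ltNge (ltW bz) in zb.
  move=> /orP[bz|z3]; first by rewrite ltNge (ltW bz) in zb.
  by rewrite z1 z2 z3 z4.
- by apply: le_lt_trans xyd; apply: ler_sum => i _; exact: clamp_dist.
Qed.

Lemma interval_continuous_continuous F : interval_continuous F -> continuous F.
Proof.
move=> Fac x; apply/cvgrPdist_lt => /= e e0.
have [d d0 fd] := Fac e e0.
have H u v : u <= v -> v - u < d -> `|F v - F u| < e.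
  move=> uv uvd; have := fd 1%N (fun=> u) (fun=> v).
  rewrite !big_ord1; apply => //.
  by move=> i j _ _ _; rewrite (ord1 i) (ord1 j).
apply/nbhs_ballP; exists d => // y; rewrite /ball/= => xyd.
have [xy|yx] := leP x y.
  by rewrite distrC H// -(ger0_norm (_ : 0 <= y - x)) ?subr_ge0// distrC.
by rewrite H// ?(ltW yx)// -(ger0_norm (_ : 0 <= x - y)) ?subr_ge0// ltW.
Qed.

Lemma ac_nondecreasing_primitive a b F : a <= b ->
  absolutely_continuous a b F -> {in `[a, b] &, nondecreasing_fun F} ->
  exists2 g : R -> R, mu.-integrable setT (EFin \o g) &
    forall x, a <= x -> x <= b -> F x - F a = (\int[mu]_(t in `[a, x]) g t)%R.
Proof.
move=> ab Fac Fnd.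
(* Extension by constants gives a Stieltjes measure of total mass at most [F b - F a]; being finite,
   it has a density integrable over the whole line. *)
pose G := F \o clamp a b.
have Gac' : interval_continuous G by exact: ac_clamp.
have Gnd : nondecreasing G.
  move=> x y xy; apply: Fnd; last exact: clamp_homo.
    by rewrite in_itv/= clamp_ge clamp_le.
  by rewrite in_itv/= clamp_ge clamp_le.
have Grc : right_continuous G.
  exact/right_continuousW/interval_continuous_continuous.
pose Gm := isCumulative.Build R _ R G Gnd Grc.
pose H : cumulative R R := HB.pack G Gm.
have HE x : a <= x -> x <= b -> H x = F x.
  by move=> ax xb; rewrite /H/= /G/= clampE.
pose m := lebesgue_stieltjes_measure H.
have Hle x y : H y - H x <= F b - F a.
  by rewrite lerB//; apply: Fnd; rewrite ?in_itv/= ?clamp_ge ?clamp_le ?lexx ?ab.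
have mT : (m setT < +oo)%E.
  apply: (@le_lt_trans _ _ (F b - F a)%:E); last exact: ltry.
  rewrite -(bigcup_itvT false false).
  have : m (`]- n%:R, n%:R]%classic : set R) @[n --> \oo] -->
      m (\bigcup_n (`]- n%:R, n%:R]%classic : set R)).
    apply: nondecreasing_cvg_mu => //; first exact: bigcup_measurable.
    by move=> *; apply/subsetPset/subset_itv; rewrite leBSide/= ?lerN2 ler_nat.
  move=> /cvg_lim <-//; apply: lime_le.
    apply/cvg_ex; eexists; apply: nondecreasing_cvg_mu => //.
      exact: bigcup_measurable.
    by move=> *; apply/subsetPset/subset_itv; rewrite leBSide/= ?lerN2 ler_nat.
  apply: nearW => n; rewrite /m lebesgue_stieltjes_oc ?lee_fin//.
  by rewrite (@le_trans _ _ 0)// lerNl oppr0.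
pose nu : {finite_measure set (measurableTypeR R) -> \bar R} := mfrestr measurableT mT.
have nuE A : nu A = m A by rewrite /nu/= /mfrestr/= /mrestr setIT.
have numu : nu `<< mu.
  apply/null_content_dominatesP => A mA A0; rewrite nuE.
  have /null_content_dominatesP := @lebesgue_stieltjes_dominated R H Gac'.
  exact.
have [f [f0 ffin fint fE]] := radon_nikodym_sigma_finite numu.
have fK : EFin \o (fine \o f) = f by apply/funext => x /=; rewrite fineK.
exists (fine \o f); first by rewrite fK.
move=> x ax xb; rewrite /Rintegral.
under eq_integral do rewrite fineK//.
rewrite -integral_itv_obnd_cbnd; last first.
  by apply: measurable_funTS; case/integrableP : fint.
by rewrite -fE// nuE /m lebesgue_stieltjes_oc// !HE.
Qed.

End absolute_continuity_primitive.

(** * The fundamental theorem of calculus *)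

Section absolute_continuity_ftc.
Context {R : realType}.
Notation mu := (@lebesgue_measure R).
Implicit Types (a b : R) (f g F : R -> R).

(** The monotone case applies to [V] and to [V - f], where [V] is the variation function: increments
    of [f] are bounded by those of [V], so both are nondecreasing, and [f] is their difference. *)
Lemma ac_primitive a b f : a <= b -> absolutely_continuous a b f ->
  exists2 g : R -> R, mu.-integrable setT (EFin \o g) &
    forall x, a <= x -> x <= b -> f x - f a = (\int[mu]_(t in `[a, x]) g t)%R.
Proof.
move=> ab fac.
pose V x := fine (total_variation a x f).
have Vac : absolutely_continuous a b V by exact: ac_fine_total_variation.
have bv := ac_bounded_variation ab fac.
have tvfin x y : a <= x -> x <= y -> y <= b -> total_variation x y f \is a fin_num.
  move=> ax xy yb; apply/(bounded_variationP _ xy).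
  apply: (bounded_variationr ax xy).
  exact: bounded_variationl (le_trans ax xy) yb bv.
have VB x y : a <= x -> x <= y -> y <= b -> `|f y - f x| <= V y - V x.
  move=> ax xy yb; rewrite -lee_fin /V EFinB.
  rewrite !fineK ?tvfin ?(le_trans ax xy) ?(le_trans xy)//.
  rewrite (total_variationD f ax xy) addeAC subee ?add0e ?total_variation_ge//.
  by rewrite tvfin// (le_trans xy).
have [|g1 ig1 g1E] := @ac_nondecreasing_primitive R a b V ab Vac.
  move=> x y; rewrite !in_itv/= => /andP[ax xb] /andP[ay yb] xy.
  by rewrite -subr_ge0 (le_trans _ (VB _ _ ax xy yb)).
have [||g2 ig2 g2E] := @ac_nondecreasing_primitive R a b (fun x => V x - f x) ab.
- exact: acB.
- move=> x y; rewrite !in_itv/= => /andP[ax xb] /andP[ay yb] xy.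
  by have := le_trans (ler_norm _) (VB _ _ ax xy yb); lra.
exists (fun x => g1 x - g2 x).
  by apply: (integrableB measurableT ig1 ig2).
move=> x ax xb; rewrite RintegralB//; last 2 first.
- exact: integrableS ig1.
- exact: integrableS ig2.
by rewrite -g1E// -g2E//; ring.
Qed.

Lemma derivable_is_derive1 F x : derivable F x 1 -> is_derive x 1 F (derive1 F x).
Proof. by move=> dF; rewrite derive1E; exact: derivableP. Qed.

Lemma near_eq_shift F (G : R -> R) x l :
  (exists c, {near x, (fun y => G y + c) =1 F}) ->
  derivable G x 1 -> derive1 G x = l -> derivable F x 1 /\ derive1 F x = l.
Proof.
move=> [c GF] dG <-.
have idG : is_derive x 1 (fun y => G y + c) (derive1 G x).
  rewrite -[derive1 G x]addr0; apply: is_deriveD.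
  exact: derivable_is_derive1.
have [dF FE] := near_eq_is_derive GF idG.
by rewrite derive1E.
Qed.

Lemma primitive_derivable a b F g : mu.-integrable setT (EFin \o g) ->
  (forall x, a <= x -> x <= b -> F x - F a = (\int[mu]_(t in `[a, x]) g t)%R) ->
  {ae mu, forall x, a < x < b -> derivable F x 1 /\ derive1 F x = g x}.
Proof.
move=> ig FE.
have /lebesgue_differentiation : locally_integrable [set: R] g.
  by apply: open_integrable_locally => //; exact: openT.
apply: filterS; first exact: (ae_filter_ringOfSetsType mu).
move=> x gx /andP[ax xb].
have [|dG GE] := @FTC1_lebesgue_pt R g (BLeft a) x b xb _ ax gx.
  exact: integrableS ig.
apply: near_eq_shift dG GE; exists (F a); near=> y.
rewrite -FE ?subrK//.
  by apply/ltW; near: y; exact: lt_nbhsr.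
by apply/ltW; near: y; exact: lt_nbhsl.
Unshelve. all: by end_near. Qed.

Lemma ac_ftc a b f : a <= b -> absolutely_continuous a b f ->
  exists g : R -> R, [/\ mu.-integrable setT (EFin \o g),
    forall x, a <= x -> x <= b -> f x - f a = (\int[mu]_(t in `[a, x]) g t)%R &
    {ae mu, forall x, a < x < b -> derivable f x 1 /\ derive1 f x = g x}].
Proof.
move=> ab fac; have [g ig gE] := ac_primitive ab fac.
by exists g; split => //; exact: primitive_derivable ig gE.
Qed.

Lemma ae_itv_symmetric (P : R -> Prop) :
  (forall n, {ae mu, forall x, - n%:R < x < n%:R -> P x}) -> {ae mu, forall x, P x}.
Proof.
move=> /ae_foralln; apply: filterS => x /(_ (Num.truncn `|x|).+1); apply.
by rewrite -ltr_norml truncnS_gt.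
Qed.

Lemma loc_ac_derivable f : loc_absolutely_continuous f ->
  {ae mu, forall x, derivable f x 1}.
Proof.
move=> fac; apply: ae_itv_symmetric => -[|n].
  by apply: aeW => x; rewrite oppr0 => /andP[/lt_trans h /h]; rewrite ltxx.
have h : - n.+1%:R < n.+1%:R :> R by rewrite (@lt_trans _ _ 0)// oppr_lt0.
have [g [_ _]] := ac_ftc (ltW h) (fac _ _ h).
apply: filterS; first exact: (ae_filter_ringOfSetsType mu).
by move=> x /[apply] -[].
Qed.

Lemma ac_derive0 a b f : a <= b -> absolutely_continuous a b f ->
  {ae mu, forall x, a < x < b -> derive1 f x = 0} -> f b = f a.
Proof.
move=> ab fac f0; have [g [ig gE gf]] := ac_ftc ab fac.
apply/eqP; rewrite -subr_eq0 gE// /Rintegral.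
rewrite -integral_itv_bndo_bndc; last first.
  by apply: measurable_funTS; case/integrableP : ig.
rewrite -integral_itv_obnd_cbnd; last first.
  by apply: measurable_funTS; case/integrableP : ig.
rewrite (@ae_eq_integral _ _ _ mu _ (cst 0%E))//=.
- by rewrite integral_cst//= mul0e.
- by apply: measurable_funTS; case/integrableP : ig.
- move: f0 gf; apply: filterS2; first exact: (ae_filter_ringOfSetsType mu).
  move=> x f0 gf; rewrite /= in_itv/= => axb.
  by have [_ <-] := gf axb; rewrite f0.
Qed.

End absolute_continuity_ftc.

(** * Exponentials and indefinite integrals *)

Section absolute_continuity_examples.
Context {R : realType}.
Notation mu := (@lebesgue_measure R).
Implicit Types (a b : R) (f g F : R -> R).

Lemma ac_expR a b : absolutely_continuous a b (@expR R).
Proof.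
apply: (@ac_le R a b (expR b) idfun idfun); first exact: expR_ge0.
- move=> x y ax xy yb /=.
  rewrite ger0_norm; last by rewrite subr_ge0 ler_expR.
  have -> : expR y - expR x = expR y * (1 - expR (x - y)).
    by rewrite mulrBr mulr1 -expRD subrKC.
  have h : 1 - expR (x - y) <= y - x by have := expR_ge1Dx (x - y); lra.
  rewrite (@le_trans _ _ (expR y * (y - x)))//.
    by rewrite ler_wpM2l// expR_ge0.
  rewrite ler_pM ?expR_ge0 ?subr_ge0 ?ler_expR//.
  by rewrite ger0_norm ?subr_ge0//; lra.
- exact: ac_id.
- exact: ac_id.
Qed.

Lemma ac_expRN a b : absolutely_continuous a b (fun x : R => expR (- x)).
Proof.
apply: (@ac_le R a b (expR (- a)) idfun idfun); first exact: expR_ge0.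
- move=> x y ax xy yb /=.
  rewrite distrC ger0_norm; last by rewrite subr_ge0 ler_expR lerN2.
  have -> : expR (- x) - expR (- y) = expR (- x) * (1 - expR (x - y)).
    by rewrite mulrBr mulr1 -expRD addKr.
  have h : 1 - expR (x - y) <= y - x by have := expR_ge1Dx (x - y); lra.
  rewrite (@le_trans _ _ (expR (- x) * (y - x)))//.
    by rewrite ler_wpM2l// expR_ge0.
  rewrite ler_pM ?expR_ge0 ?subr_ge0 ?ler_expR ?lerN2//.
  by rewrite ger0_norm ?subr_ge0//; lra.
- exact: ac_id.
- exact: ac_id.
Qed.

(** The integral of [|g|] over a set tends to zero with the measure of the set; here the set is the
    union of the given disjoint intervals. *)
Lemma ac_le_integral a b F g : mu.-integrable `[a, b] (EFin \o g) ->
  (forall x y, a <= x -> x <= y -> y <= b ->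
    (`|F y - F x|%:E <= \int[mu]_(t in `[x, y]) `|g t|%:E)%E) ->
  absolutely_continuous a b F.
Proof.
move=> ig Fg e e0.
pose h := g \_ (`[a, b]%classic : set R).
have ih : mu.-integrable setT (EFin \o h).
  by rewrite /h -restrict_EFin -integrable_mkcond.
have [d [d0 hd]] := integral_normr_continuous ih e0.
exists d => // n x y xy txy xyd.
have mh : measurable_fun setT (fun t => `|h t|%:E).
  apply/measurable_EFinP; apply: measurableT_comp => //.
  by apply/measurable_EFinP; case/integrableP : ih.
pose A := \big[setU/set0]_(i < n) (`]x i, y i[%classic : set R).
have mA : measurable A by apply: bigsetU_measurable.
have muI i : (mu (`]x i, y i[%classic : set R) <= (y i - x i)%:E)%E.
  rewrite lebesgue_measure_itv/= lte_fin.
  by case: ltP => // h'; rewrite lee_fin subr_ge0; have [_ []] := xy i.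
have muA : (mu A < d%:E)%E.
  rewrite measure_bigsetU_ord// (@le_lt_trans _ _ (\sum_(i < n) (y i - x i)%:E)%E)//.
    by apply: lee_sum => i _; exact: muI.
  by rewrite sumEFin lte_fin.
have := hd A mA muA; rewrite -lte_fin => hdA; rewrite -lte_fin; apply: le_lt_trans hdA.
rewrite /Rintegral fineK; last first.
  apply: integrable_fin_num; first exact: mA.
  apply: (@integrableS _ _ _ mu setT A _ measurableT mA (@subsetT _ _)).
  exact: (integrable_norm ih).
rewrite -sumEFin ge0_integral_bigsetU//=; last 3 first.
- exact: index_enum_uniq.
- exact: sub_trivIset txy.
- exact: measurable_funTS.
apply: lee_sum => i _; have [ax [xiy yb]] := xy i.
apply: le_trans (Fg _ _ ax xiy yb) _.
rewrite le_eqVlt; apply/orP; left; apply/eqP.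
transitivity (\int[mu]_(t in `[x i, y i]) `|h t|%:E)%E.
  apply: eq_integral => t; rewrite inE/= in_itv/= => /andP[xt ty].
  rewrite /h patchE mem_set//= in_itv/=.
  by rewrite (le_trans ax xt) (le_trans ty yb).
rewrite -integral_itv_bndo_bndc; last exact: measurable_funTS.
by rewrite -integral_itv_obnd_cbnd; last exact: measurable_funTS.
Qed.

Lemma loc_ac_continuous f : loc_absolutely_continuous f -> continuous f.
Proof.
move=> fac x; apply/cvgrPdist_lt => /= e e0.
have h : x - 1 < x + 1 by lra.
have [d d0 fd] := ac_unif_continuous (fac _ _ h) e0.
near=> y.
have xyd : `|x - y| < d by near: y; apply/nbhs_ballP; exists d => // z.
have : `|x - y| < 1 by near: y; apply/nbhs_ballP; exists 1 => //= z.
rewrite ltr_distl => /andP[y1 y2].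
have [xy|yx] := leP x y.
  rewrite distrC fd//; [lra|lra|].
  by rewrite -(ger0_norm (_ : 0 <= y - x)) ?subr_ge0// distrC.
rewrite fd// ?(ltW yx)//; [lra|lra|].
by rewrite -(ger0_norm (_ : 0 <= x - y)) ?subr_ge0// ltW.
Unshelve. all: by end_near. Qed.

End absolute_continuity_examples.

(** * Measurability of the derivative *)

Section derive1_measurable.
Context {R : realType}.
Variable u : R -> R.
Hypothesis cu : continuous u.

Let q (h x : R) := h^-1 *: (u (h + x) - u x).

Let cq h : continuous (q h).
Proof.
move=> x; apply: cvgZr; apply: cvgB; last exact: cu.
apply: (@cvg_comp _ _ _ (fun y => h + y) u _ (nbhs (h + x))); last exact: cu.
by apply: cvgD; [exact: cvg_cst|exact: cvg_id].
Qed.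

(* [D] below is the set of points where the difference quotients satisfy the
   Cauchy criterion.  It is Borel because, for fixed increments, the quotients are
   continuous in [x], so that [E k n] is an intersection of closed sets. *)
Let E (k n : nat) : set R := [set x | forall h h' : R,
  0 < `|h| < n.+1%:R^-1 -> 0 < `|h'| < n.+1%:R^-1 ->
  `|q h x - q h' x| <= k.+1%:R^-1].

Let closedE k n : closed (E k n).
Proof.
rewrite [E k n](_ : _ = \bigcap_(p in [set p : R * R |
    0 < `|p.1| < n.+1%:R^-1 /\ 0 < `|p.2| < n.+1%:R^-1])
    [set x | `|q p.1 x - q p.2 x| <= k.+1%:R^-1]); last first.
  apply/seteqP; split => [x Ex [h h'] /= [h0 h'0]|x Ex h h' h0 h'0].
    exact: Ex.
  exact: (Ex (h, h')).
apply: closed_bigI => -[h h'] _ /=.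
apply: (@preimage_closed _ _ (fun x => `|q h x - q h' x|) [set y | y <= k.+1%:R^-1]).
  by move=> x _; apply: cvg_norm; apply: cvgB; exact: cq.
exact: closed_le.
Qed.

Let D := \bigcap_k \bigcup_n E k n.

Let mD : measurable D.
Proof.
apply: bigcapT_measurable => k; apply: bigcupT_measurable => n.
exact: closed_measurable.
Qed.

Let DP x : D x <-> cvg (q h x @[h --> 0^']).
Proof.
split=> [Dx|/cvg_ex[/= l /cvgrPdist_lt ql] k _].
  apply/cauchy_cvgP/cauchy_exP => e e0.
  have [n _ Exn] := Dx (Num.truncn e^-1) I.
  have n0 : 0 < n.+1%:R^-1 :> R by rewrite invr_gt0.
  (* Half the bound is an increment strictly inside the range that [E] quantifies over. *)
  exists (q (n.+1%:R^-1 / 2) x).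
  exists n.+1%:R^-1 => //= h; rewrite /ball/= sub0r normrN => hn h0.
  apply: le_lt_trans (Exn _ h _ _) _.
  - rewrite normr_gt0 gt_eqF ?divr_gt0//= gtr0_norm ?divr_gt0//.
    by rewrite ltr_pdivrMr// ltr_pMr// ltr1n.
  - by rewrite normr_gt0 h0.
  - by rewrite invf_plt ?posrE// truncnS_gt.
have k0 : 0 < k.+1%:R^-1 / 2 :> R by rewrite divr_gt0.
have [d /= d0 dl] := ql _ k0.
exists (Num.truncn d^-1) => // h h' /andP[h0 hd] /andP[h'0 h'd].
have dd : (Num.truncn d^-1).+1%:R^-1 < d by rewrite invf_plt ?posrE// truncnS_gt.
have H z : 0 < `|z| -> `|z| < (Num.truncn d^-1).+1%:R^-1 ->
    `|l - q z x| < k.+1%:R^-1 / 2.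
  move=> z0 zd; apply: dl => /=; last by rewrite -normr_gt0.
  by rewrite /ball/= sub0r normrN (lt_trans zd).
rewrite (_ : _ - _ = (l - q h' x) - (l - q h x)); last by ring.
rewrite (le_trans (ler_normB _ _))// ltW// [ltRHS]splitr.
by rewrite ltrD ?H.
Qed.

(** On [D] the derivative is the pointwise limit of the continuous quotients along the increments
    [n.+1%:R^-1]. *)
Lemma measurable_derive1 : measurable_fun [set: R] (derive1 u).
Proof.
rewrite -(setUv D); apply/measurable_funU => //; first exact: measurableC.
split.
  apply: (@measurable_fun_cvg _ _ R D (fun n => q n.+1%:R^-1)).
    move=> n; apply: measurable_funTS; apply: continuous_measurable_fun; exact: cq.
  move=> x /DP qx; rewrite /derive1.
  move: qx; apply: cvg_comp => A [e /= e0 eA].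
  have [n _ nP] := near_infty_natSinv_lt (PosNum e0).
  exists n => //= m /nP; rewrite /= => me; apply: eA => //=.
    by rewrite sub0r normrN gtr0_norm// invr_gt0.
(* Off [D] the limit does not exist and [lim] is the default value [point]. *)
apply: (@eq_measurable_fun _ _ _ _ _ (cst point)) => //.
move=> x /set_mem Dx; rewrite /derive1; apply/esym/getPN => l ql; apply: Dx.
by apply/DP; apply/cvg_ex; exists l.
Qed.

End derive1_measurable.

(** * Change of variables *)

Section transport_measure.
Context d d' (T : measurableType d) (T' : measurableType d') (R : realType).
Context (m : {measure set T -> \bar R}) (phi : T -> T') (h : T -> R).
Context (mphi : measurable_fun [set: T] phi) (mh : measurable_fun [set: T] h).
Context (h0 : forall x, 0 <= h x).
Import HBNNSimple.
Local Open Scope ereal_scope.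

(* The image under [phi] of the measure with density [h] with respect to [m]; the
   proofs are arguments so that the measure structure can be inferred. *)
Definition transport of measurable_fun [set: T] phi & measurable_fun [set: T] h &
    (forall x, (0 <= h x)%R) :=
  fun A : set T' => \int[m]_(x in phi @^-1` A) (h x)%:E.

Local Notation nu := (transport mphi mh h0).

Let measurable_preimage A : measurable A -> measurable (phi @^-1` A).
Proof. by move=> mA; rewrite -[X in measurable X]setTI; exact: mphi. Qed.

Let memE (S : set T') x : (x \in phi @^-1` S) = (phi x \in S).
Proof. by apply/idP/idP => /set_mem/= ?; apply/mem_set. Qed.

Let mEh : measurable_fun [set: T] (EFin \o h).
Proof. exact/measurable_EFinP. Qed.

Let transport0 : nu set0 = 0.
Proof. by rewrite /transport preimage_set0 integral_set0. Qed.

Let transport_ge0 A : 0 <= nu A.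
Proof. by apply: integral_ge0 => x _; rewrite lee_fin. Qed.

Let transport_sigma_additive : semi_sigma_additive nu.
Proof.
move=> F mF tF mUF; rewrite /transport preimage_bigcup.
apply: (@semi_sigma_additive_nng_induced _ _ _ m (EFin \o h) _ _
    (fun n => phi @^-1` F n)) => //.
- by move=> n; exact: measurable_preimage.
- apply/trivIsetP => i j _ _ ij; rewrite -preimage_setI.
  by move/trivIsetP : tF => ->//; rewrite preimage_set0.
- by rewrite -preimage_bigcup; exact: measurable_preimage.
Qed.

HB.instance Definition _ := isMeasure.Build _ _ _ nu
  transport0 transport_ge0 transport_sigma_additive.

Let integral_transport_nnsfun (f : {nnsfun T' >-> R}) :
  \int[nu]_y (f y)%:E = \int[m]_x (f (phi x) * h x)%:E.
Proof.
have fE y : (f y)%:E = \sum_(r \in range f) (r * \1_(f @^-1` [set r]) y)%:E.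
  by rewrite fimfunE -fsumEFin.
have mf r : measurable (f @^-1` [set r]) by [].
transitivity (\int[nu]_y \sum_(r \in range f) (r * \1_(f @^-1` [set r]) y)%:E).
  by apply: eq_integral => y _; exact: fE.
rewrite ge0_integral_fsum//; last 2 first.
- by move=> r; apply/measurable_EFinP; exact: measurable_funM.
- by move=> r y _; exact: nnfun_muleindic_ge0.
transitivity (\int[m]_x \sum_(r \in range f)
    ((r * \1_(f @^-1` [set r]) (phi x))%:E * (h x)%:E)); last first.
  apply: eq_integral => x _; rewrite EFinM fE ge0_mule_fsuml// => r.
  exact: nnfun_muleindic_ge0.
rewrite ge0_integral_fsum//; last 2 first.
- move=> r; apply: emeasurable_funM => //.
  apply: (@measurableT_comp _ _ _ _ _ _
    (fun y => (r * \1_(f @^-1` [set r]) y)%:E)) => //.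
  by apply/measurable_EFinP; exact: measurable_funM.
- by move=> r x _; rewrite mule_ge0 ?lee_fin//; exact: nnfun_muleindic_ge0.
apply: eq_fsbigr => r /set_mem[y0 _ <-].
rewrite integralZl_indic_nnsfun// integral_indic// setIT.
under [RHS]eq_integral do rewrite EFinM -muleA.
rewrite ge0_integralZl//; last 3 first.
- apply: emeasurable_funM => //; apply/measurable_EFinP.
  by apply: measurableT_comp => //; exact: measurable_indic.
- by move=> x _; rewrite mule_ge0 ?lee_fin.
- by rewrite lee_fin.
congr (_ * _).
transitivity (\int[m]_(x in phi @^-1` (f @^-1` [set f y0])) (h x)%:E) => //.
rewrite [LHS]integral_mkcond; apply: eq_integral => x _ /=.
by rewrite patchE indicE memE; case: ifP => _; rewrite ?mul1e ?mul0e.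
Qed.

(** Image and density are treated at once because the transports between [ups] and [nu] combine
    both. The passage is from simple functions to [g \_ A] by monotone convergence. *)
Lemma integral_transport (g : T' -> \bar R) A : measurable A ->
  measurable_fun [set: T'] g -> (forall y, 0 <= g y) ->
  \int[nu]_(y in A) g y = \int[m]_(x in phi @^-1` A) (g (phi x) * (h x)%:E).
Proof.
move=> mA mg g0; rewrite [LHS]integral_mkcond [RHS]integral_mkcond.
set gA := g \_ A.
have mgA : measurable_fun setT gA.
  by apply/(measurable_restrictT _ _).1 => //; exact: measurable_funTS.
have gA0 y : 0 <= gA y by exact: erestrict_ge0.
transitivity (\int[m]_x (gA (phi x) * (h x)%:E)); last first.
  apply: eq_integral => x _; rewrite /gA !patchE memE.
  by case: ifP => // _; rewrite /= mul0e.
pose f := nnsfun_approx measurableT mgA.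
have fgA y : (f n y)%:E @[n --> \oo] --> gA y by exact: cvg_nnsfun_approx.
have fnd y : nondecreasing_seq (fun n => f n y).
  by move=> i j ij; exact/lefP/nd_nnsfun_approx.
transitivity (limn (fun n => \int[nu]_y (f n y)%:E)).
  rewrite -monotone_convergence//=.
  - by apply: eq_integral => y _; apply/esym/cvg_lim.
  - by move=> n; apply/measurable_EFinP.
  - by move=> n y _; rewrite lee_fin.
  - by move=> y _ i j ij; rewrite lee_fin fnd.
under eq_fun do rewrite integral_transport_nnsfun.
rewrite -monotone_convergence//=.
- apply: eq_integral => x _; apply/cvg_lim => //.
  under eq_fun do rewrite EFinM.
  by apply: cvgeZr.
- move=> n; apply/measurable_EFinP; apply: measurable_funM => //.
  exact: measurableT_comp.
- by move=> n x _; rewrite lee_fin mulr_ge0.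
- by move=> x _ i j ij; rewrite lee_fin ler_wpM2r// fnd.
Qed.

End transport_measure.

(** * The substitution y = exp x *)

Section expR_change_of_variables.
Context {R : realType}.
Notation mu := (@lebesgue_measure R).
Local Open Scope ereal_scope.

(* The image of [A] under [expR]: the restriction to positive reals is needed
   because [ln] takes the value [0] elsewhere. *)
Local Notation exp_of A := (`]0%R, +oo[%classic `&` (@ln R) @^-1` A).

Lemma measurable_preimage_ln (A : set R) : measurable A -> measurable ((@ln R) @^-1` A).
Proof. by move=> mA; rewrite -[X in measurable X]setTI; exact: measurable_ln. Qed.

Lemma measurable_exp_of (A : set R) : measurable A -> measurable (exp_of A).
Proof. by move=> mA; apply: measurableI => //; exact: measurable_preimage_ln. Qed.

Let indic_ge0 (x : R) : (0 <= \1_(`]0%R, +oo[%classic : set R) x :> R)%R.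
Proof. by rewrite indicE. Qed.

Let mindic : measurable_fun [set: R] (\1_(`]0%R, +oo[%classic : set R) : R -> R).
Proof. by apply: measurable_indic. Qed.

Let m1 : {measure set (measurableTypeR R) -> \bar R} :=
  @transport _ _ (measurableTypeR R) (measurableTypeR R) R mu id (@expR R)
    (@measurable_id _ (measurableTypeR R) setT) (@measurable_expR R) (@expR_ge0 R).

(** The indicator, used as a density, removes the half-line []-oo, 0]], which [ln] would otherwise
    collapse to an atom of infinite mass at 0. *)
Let m2 : {measure set (measurableTypeR R) -> \bar R} :=
  @transport _ _ (measurableTypeR R) (measurableTypeR R) R mu (@ln R) _
    (@measurable_ln R) mindic indic_ge0.

Let m2E X : measurable X -> m2 X = mu (`]0%R, +oo[ `&` (@ln R) @^-1` X).
Proof.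
move=> mX.
transitivity (\int[mu]_(x in (@ln R) @^-1` X)
    (\1_(`]0%R, +oo[%classic : set R) x)%:E) => //.
by rewrite integral_indic// -[X in measurable X]setTI; exact: measurable_ln.
Qed.

(* Both sides are the Lebesgue-Stieltjes measure of [expR]. *)
Lemma lebesgue_expR_ln A : measurable A ->
  \int[mu]_(x in A) (expR x)%:E = mu (`]0%R, +oo[ `&` (@ln R) @^-1` A).
Proof.
move=> mA.
have expR_nd : nondecreasing (@expR R) by move=> x y; rewrite ler_expR.
have expR_rc : right_continuous (@expR R).
  by apply: right_continuousW; exact: continuous_expR.
pose Em := isCumulative.Build R _ R (@expR R) expR_nd expR_rc.
pose F : cumulative R R := HB.pack (@expR R) Em.
have m1E : \int[mu]_(x in A) (expR x)%:E = m1 A by [].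
rewrite m1E -m2E//.
rewrite -(@lebesgue_stieltjes_measure_unique R F m1)//.
  apply: lebesgue_stieltjes_measure_unique => // _ [[a b] _ <-] /=.
  have [ab|ba] := leP a b; last by rewrite set_itv_ge ?measure0// bnd_simp -leNgt ltW.
  rewrite lebesgue_stieltjes_oc//= m2E//.
  rewrite [X in mu X](_ : _ = `]expR a, expR b]%classic).
    rewrite lebesgue_measure_itv/= lte_fin.
    rewrite ltNge ler_expR; case: (leP b a) => //= ba.
    by rewrite (le_anti (_ : a <= b <= a)%R) ?subrr// ab.
  apply/seteqP; split=> y /=; rewrite !in_itv/= ?andbT.
    by move=> [y0 /andP[ay yb]]; rewrite -{1 2}(lnK y0) ltr_expR ler_expR ay.
  move=> /andP[ay yb]; have y0 : (0 < y)%R by exact: lt_trans (expR_gt0 a) ay.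
  split=> //.
  by rewrite -ltr_expR -[(_ <= b)%R]ler_expR !lnK ?posrE// ay.
move=> _ [[a b] _ <-] /=.
have [ab|ba] := ltP a b; last first.
  by rewrite set_itv_ge ?measure0// bnd_simp -leNgt.
rewrite lebesgue_stieltjes_oc ?(ltW ab)//=.
transitivity (\int[mu]_(x in `]a, b]) (expR x)%:E) => //.
rewrite integral_itv_obnd_cbnd; last first.
  by apply/measurable_EFinP/measurable_funTS; exact: measurable_expR.
rewrite (@continuous_FTC2 _ _ (@expR R))// ?EFinB//.
- by apply: continuous_subspaceT; exact: continuous_expR.
- split.
  + by move=> x _; exact: derivable_expR.
  + exact/cvg_at_right_filter/continuous_expR.
  + exact/cvg_at_left_filter/continuous_expR.
- by move=> x _; rewrite derive1E derive_val.
Qed.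

Lemma integral_expR_ln (g : R -> \bar R) A : measurable A ->
  measurable_fun [set: R] g -> (forall y, 0 <= g y) ->
  \int[mu]_(x in A) (g x * (expR x)%:E) =
  \int[mu]_(y in `]0%R, +oo[ `&` (@ln R) @^-1` A) g (ln y).
Proof.
move=> mA mg g0.
transitivity (\int[m1]_(x in A) g x).
  by rewrite integral_transport.
transitivity (\int[m2]_(x in A) g x).
  apply: eq_measure_integral => B mB _.
  transitivity (\int[mu]_(x in B) (expR x)%:E) => //.
  by rewrite lebesgue_expR_ln// -m2E.
rewrite integral_transport// integral_mkcondl.
by apply: eq_integral => y _; rewrite patchE indicE; case: ifP; rewrite ?mule1 ?mule0.
Qed.

(** The part of the preimage of a null set [N] in []0, +oo[] has as measure the integral of [expR]
    over [N], which vanishes. *)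
Lemma ae_ln (P : R -> Prop) : {ae mu, forall x, P x} ->
  {ae mu, forall y, (0 < y)%R -> P (ln y)}.
Proof.
move=> [N [mN N0 PN]].
exists (`]0%R, +oo[ `&` (@ln R) @^-1` N); split.
- exact: measurable_exp_of.
- rewrite -lebesgue_expR_ln// null_set_integral//.
  by apply/measurable_EFinP/measurable_funTS; exact: measurable_expR.
- move=> y /= /not_implyP[y0 Py]; split; first by rewrite /= in_itv/= y0.
  exact: PN.
Qed.

Lemma ae_expR (P : R -> Prop) : {ae mu, forall y, (0 < y)%R -> P y} ->
  {ae mu, forall x, P (expR x)}.
Proof.
move=> [N [mN N0 PN]].
have mM : measurable ((@expR R) @^-1` N).
  by rewrite -[X in measurable X]setTI; exact: measurable_expR.
exists ((@expR R) @^-1` N); split => //.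
  have mexpN : measurable_fun [set: R] (fun x : R => (expR (- x))%:E).
    by apply/measurable_EFinP; apply: measurableT_comp => //; exact: measurable_expR.
  (* Writing 1 as [expR (- x) * expR x] lets the substitution turn the measure of the preimage into
     an integral over a subset of [N]. *)
  transitivity (\int[mu]_(x in (@expR R) @^-1` N) ((expR (- x))%:E * (expR x)%:E)).
    under eq_integral do rewrite -EFinM -expRD addNr expR0.
    by rewrite integral_cst// mul1e.
  rewrite integral_expR_ln//.
  apply: null_set_integral.
  - exact: measurable_exp_of.
  - apply: measurable_funTS; apply: (measurableT_comp mexpN); exact: measurable_ln.
  - apply: (subset_measure0 _ mN) N0 => //.
      exact: measurable_exp_of.
    by move=> y [/=]; rewrite in_itv/= andbT => y0; rewrite lnK.
move=> x /= Px; apply: PN => /= h; apply: Px; apply: h; exact: expR_gt0.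
Qed.

End expR_change_of_variables.

(** * The measure upsilon *)

Section pinfty.
Context {R : realType}.
Local Open Scope ereal_scope.

Lemma limf_esup_pinfty_ltyP (g : R -> \bar R) :
  limf_esup g (pinfty_nbhs R) < +oo <->
  exists M C : R, forall x, (M < x)%R -> g x <= C%:E.
Proof.
split=> [/ereal_inf_lt[_ [V VF <-] gV]|[M [C gC]]].
  have [M [Mr MV]] := VF.
  have [C gVC] : exists C : R, ereal_sup [set g x | x in V] <= C%:E.
    case: (ereal_sup _) gV => [r _| //|_]; first by exists r.
    by exists 0%R; rewrite leNye.
  exists M, C => x Mx; apply: le_trans gVC.
  by apply: ereal_sup_ubound; exists x => //; exact: MV.
apply: (@le_lt_trans _ _ C%:E); last exact: ltry.
apply: ge_ereal_inf; exists (ereal_sup [set g x | x in `]M, +oo[%classic]).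
  exists `]M, +oo[%classic => //; exists M; split; first exact: num_real.
  by move=> x Mx /=; rewrite in_itv/= Mx.
by apply: ge_ereal_sup => _ [x /= + <-]; rewrite in_itv/= andbT; exact: gC.
Qed.

Lemma limf_esup_ln (a b : R -> \bar R) : (forall y, (0 < y)%R -> b y = a (ln y)) ->
  limf_esup a (pinfty_nbhs R) < +oo <-> limf_esup b (pinfty_nbhs R) < +oo.
Proof.
move=> ab; split=> /limf_esup_pinfty_ltyP[M [C H]]; apply/limf_esup_pinfty_ltyP.
- exists (expR M), C => y My.
  have y0 : (0 < y)%R by rewrite (lt_trans (expR_gt0 M)).
  by rewrite ab// H// -ltr_expR lnK.
(* The maximum with 1 keeps the argument of [ln] positive. *)
- exists (ln (Num.max M 1%R)), C => x Mx.
  have M0 : (0 < Num.max M 1%R)%R by rewrite lt_max ltr01 orbT.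
  rewrite -[x]expRK -ab ?expR_gt0// H//.
  by rewrite -ltr_expR lnK// gt_max in Mx; case/andP: Mx.
Qed.

End pinfty.

Section upsilon.
Context {R : realType}.
Notation mu := (@lebesgue_measure R).
Implicit Types (u f : R -> R) (m : borel_measure R).
Local Open Scope ereal_scope.

Lemma H1loc_continuous u : H1loc u -> continuous u.
Proof. by move=> [/loc_ac_continuous]. Qed.

Lemma H1loc_measurable u : H1loc u -> measurable_fun [set: R] u.
Proof. by move=> /H1loc_continuous; exact: continuous_measurable_fun. Qed.

Lemma H1loc_measurable_derive u : H1loc u -> measurable_fun [set: R] (derive1 u).
Proof. by move=> [_ []]. Qed.

Lemma measurable_energy u : H1loc u ->
  measurable_fun [set: R] (fun x => u x ^+ 2 + derive1 u x ^+ 2)%R.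
Proof.
move=> uH; apply: measurable_funD; apply: measurable_funX.
  exact: H1loc_measurable.
exact: H1loc_measurable_derive.
Qed.

Lemma continuous_sqr_itv_lty u (a b : R) : continuous u ->
  \int[mu]_(x in `[a, b]) (u x ^+ 2)%:E < +oo.
Proof.
move=> cu; have mu2 := continuous_measurable_fun cu.
have cu2 : {within `[a, b], continuous (fun x => u x ^+ 2)%R}.
  apply: continuous_subspaceT => x; under eq_fun do rewrite expr2.
  by apply: cvgM; exact: cu.
have := continuous_compact_integrable (@segment_compact R a b) cu2.
move=> /integrableP[_]; apply: le_lt_trans; apply: ge0_le_integral => //=.
- by move=> x _; rewrite lee_fin sqr_ge0.
- by apply/measurable_EFinP/measurable_funTS; exact: measurable_funX.
- apply/measurable_EFinP/measurable_funTS/measurableT_comp => //.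
  exact: measurable_funX.
- by move=> x _; rewrite lee_fin ler_norm.
Qed.

Lemma energy_itv_lty u (a b : R) : H1loc u -> energy u `[a, b]%classic < +oo.
Proof.
move=> uH; have mu2 := H1loc_measurable uH.
have [_ [mu' L2u]] := uH.
rewrite /energy; under eq_integral do rewrite EFinD.
rewrite ge0_integralD//; last 4 first.
- by move=> x _; rewrite lee_fin sqr_ge0.
- by apply/measurable_EFinP/measurable_funTS; exact: measurable_funX.
- by move=> x _; rewrite lee_fin sqr_ge0.
- by apply/measurable_EFinP/measurable_funTS; exact: measurable_funX.
apply: lte_add_pinfty; last by apply: L2u; exact: segment_compact.
exact/continuous_sqr_itv_lty/H1loc_continuous.
Qed.

Lemma compact_sub_itv (K : set R) : compact K ->
  exists n : nat, K `<=` `[(- n%:R)%R, n%:R%R]%classic.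
Proof.
move=> /compact_bounded[M [_ KM]].
exists (Num.truncn (`|M| + 1)%R).+1 => x Kx.
rewrite /= in_itv/= -ler_norml.
have h : (M < `|M| + 1)%R by rewrite (le_lt_trans (ler_norm _))// ltrDl.
by rewrite (le_trans (KM _ h _ Kx))// ltW// truncnS_gt.
Qed.

Lemma locally_finiteP m : (forall n : nat, m `[(- n%:R)%R, n%:R%R]%classic < +oo) ->
  locally_finite m.
Proof.
move=> mn K cK; have [n Kn] := compact_sub_itv cK.
apply: le_lt_trans (mn n); apply: le_measure; rewrite ?inE//.
exact: compact_measurable.
Qed.

Lemma measure_itv_cvg m (B : set (measurableTypeR R)) : measurable B ->
  m (B `&` `[(- n%:R)%R, n%:R%R]%classic) @[n --> \oo] --> m B.
Proof.
move=> mB.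
have BE : B = \bigcup_n (B `&` `[(- n%:R)%R, n%:R%R]%classic).
  apply/seteqP; split => [x Bx|x [n _ []]//].
  exists (Num.truncn `|x|%R).+1 => //; split => //=.
  by rewrite in_itv/= -ler_norml ltW// truncnS_gt.
rewrite {2}BE; apply: nondecreasing_cvg_mu.
- by move=> n; exact: measurableI.
- by apply: bigcup_measurable => n _; exact: measurableI.
- move=> i j ij; apply/subsetPset => x [Bx]; rewrite /= !in_itv/= => /andP[h1 h2].
  have ijR : (i%:R <= j%:R :> R)%R by rewrite ler_nat.
  by split => //; apply/andP; split; lra.
Qed.

(** Serves to cancel the energy, which is known to be finite only on bounded sets. *)
Lemma eq_borel_itv m1 m2 : (forall B : set (measurableTypeR R), measurable B ->
    forall n : nat, m1 (B `&` `[(- n%:R)%R, n%:R%R]%classic) =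
      m2 (B `&` `[(- n%:R)%R, n%:R%R]%classic)) ->
  eq_borel m1 m2.
Proof.
move=> m12 B mB.
have h1 := @measure_itv_cvg m1 B mB; have h2 := @measure_itv_cvg m2 B mB.
by move: h1; rewrite (funext (m12 B mB)) => h1; exact: cvg_unique h1 h2.
Qed.

Lemma upsilon_unique u m m' ups ups' : H1loc u -> eq_borel m m' ->
  is_upsilon u m ups -> is_upsilon u m' ups' -> eq_borel ups ups'.
Proof.
move=> uH mm' H H'; apply: eq_borel_itv => B mB n.
have mBn : measurable (B `&` `[(- n%:R)%R, n%:R%R]%classic : set (measurableTypeR R)).
  exact: measurableI.
have efin : energy u (B `&` `[(- n%:R)%R, n%:R%R]%classic) \is a fin_num.
  rewrite ge0_fin_numE; last first.
    by apply: integral_ge0 => x _; rewrite lee_fin addr_ge0// sqr_ge0.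
  apply: le_lt_trans (energy_itv_lty (- n%:R)%R n%:R%R uH).
  apply: ge0_subset_integral => //.
  - by apply/measurable_EFinP/measurable_funTS; exact: measurable_energy.
  - by move=> x _; rewrite lee_fin addr_ge0// sqr_ge0.
by rewrite -[LHS](addeK _ efin) -[RHS](addeK _ efin) -H// -H'// mm'.
Qed.

Lemma upsilon_le u m ups (B : set (measurableTypeR R)) :
  is_upsilon u m ups -> measurable B ->
  ups B <= m B.
Proof.
move=> H mB; rewrite H// leeDl//.
by apply: integral_ge0 => x _; rewrite lee_fin addr_ge0// sqr_ge0.
Qed.

End upsilon.

(** * The correspondence in logarithmic coordinates *)

Section dictionary.
Context {R : realType}.
Notation mu := (@lebesgue_measure R).
Implicit Types (u f w : R -> R) (m ups nu : borel_measure R).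
Local Open Scope ereal_scope.

Local Notation exp_of A := (`]0%R, +oo[%classic `&` (@ln R) @^-1` A).

Lemma measurable_expRN : measurable_fun [set: R] (fun x : R => expR (- x)).
Proof. by apply: measurableT_comp => //; exact: measurable_expR. Qed.

Lemma exp_of_ray (y : R) : (0 < y)%R -> exp_of `[ln y, +oo[%classic = `[y, +oo[%classic.
Proof.
move=> y0; apply/seteqP; split=> z /=; rewrite !in_itv/= !andbT.
  by move=> [z0]; rewrite -ler_expR !lnK.
move=> yz; have z0 := lt_le_trans y0 yz; split=> //.
by rewrite -ler_expR !lnK.
Qed.

Lemma exp_of_setT : exp_of [set: R] = `]0%R, +oo[%classic.
Proof. by rewrite preimage_setT setIT. Qed.

Lemma ln_image_exp_of (A : set R) : (@ln R) @` exp_of A = A.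
Proof.
apply/seteqP; split=> [x [y [_ Ay] <-]//|x Ax].
exists (expR x); last exact: expRK.
by split; rewrite /= ?expRK// in_itv/= expR_gt0.
Qed.

Lemma integral_sqr_transform f w (A : set R) : measurable_fun [set: R] f ->
  measurable_fun (`]0%R, +oo[%classic : set R) w ->
  ae_eq mu (`]0%R, +oo[%classic : set R) w (fun y => - (f (ln y) / y))%R ->
  measurable A ->
  \int[mu]_(y in exp_of A) (w y ^+ 2)%:E =
  \int[mu]_(s in A) (expR (- s) * f s ^+ 2)%:E.
Proof.
move=> mf mw wf mA.
(* [g (ln y)] is the square of [f (ln y) / y]; the Jacobian [expR] absorbs one of the two
   exponential factors. *)
pose g (x : R) := (expR (- x) * expR (- x) * f x ^+ 2)%:E.
have mg : measurable_fun [set: R] g.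
  apply/measurable_EFinP; apply: measurable_funM; last exact: measurable_funX.
  by apply: measurable_funM; exact: measurable_expRN.
have g0 x : 0 <= g x.
  rewrite lee_fin; apply: mulr_ge0; last exact: sqr_ge0.
  by apply: mulr_ge0; exact: expR_ge0.
transitivity (\int[mu]_(s in A) (g s * (expR s)%:E)); last first.
  apply: eq_integral => s _; rewrite /g -EFinM; congr EFin.
  rewrite [LHS](_ : _ = expR (- s) * (expR (- s) * expR s) * f s ^+ 2)%R; last by ring.
  by rewrite -expRD addNr expR0 mulr1.
rewrite integral_expR_ln//.
apply: ae_eq_integral => //.
- exact: measurable_exp_of.
- apply/measurable_EFinP; apply: measurable_funX.
  by apply: measurable_funS mw => // y [].
- apply: measurable_funTS; apply: (measurableT_comp mg); exact: measurable_ln.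
- move: wf; apply: filterS => y wfy [y0 _]; rewrite wfy// /g; congr EFin.
  move: y0; rewrite /= in_itv/= andbT => y0.
  by rewrite expRN lnK// sqrrN expr_div_n expr2; field; rewrite gt_eqF.
Qed.

(** The last clause of [transform], isolated because it concerns the measures alone. *)
Definition pushes_to ups nu := forall B : set (measurableTypeR R), measurable B ->
  B `<=` `]0%R, +oo[%classic -> nu B = \int[ups]_(x in (@ln R) @` B) (expR (- x))%:E.

Lemma pushes_toE ups nu (A : set (measurableTypeR R)) : pushes_to ups nu ->
  measurable A -> nu (exp_of A) = \int[ups]_(s in A) (expR (- s))%:E.
Proof.
by move=> H mA; rewrite H ?ln_image_exp_of//; exact: measurable_exp_of.
Qed.

(** At [x = ln y] the two expressions under the limits superior are equal, once the factor [y] is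
    distributed over a sum of non-negative terms. The equivalence serves totality and surjectivity
    alike. *)
Lemma pushes_to_limsup f w ups nu : measurable_fun [set: R] f ->
  measurable_fun (`]0%R, +oo[%classic : set R) w ->
  ae_eq mu (`]0%R, +oo[%classic : set R) w (fun y => - (f (ln y) / y))%R ->
  pushes_to ups nu ->
  limf_esup (fun x : R => (expR x)%:E *
      (\int[mu]_(s in `[x, +oo[) (expR (- s) * f s ^+ 2)%:E
        + \int[ups]_(s in `[x, +oo[) (expR (- s))%:E)) (pinfty_nbhs R) < +oo <->
  limf_esup (fun x : R => x%:E * \int[mu]_(s in `[x, +oo[) (w s ^+ 2)%:E
      + x%:E * nu `[x, +oo[%classic) (pinfty_nbhs R) < +oo.
Proof.
move=> mf mw wf H; apply: limf_esup_ln => y y0.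
rewrite lnK// -(integral_sqr_transform mf mw wf)// -(pushes_toE H)//.
rewrite exp_of_ray//; apply/esym/ge0_muleDr; last exact: measure_ge0.
by apply: integral_ge0 => s _; rewrite lee_fin sqr_ge0.
Qed.

(** [transform] prescribes [nu] by a formula only on Borel subsets of []0, +oo[]; the two
    normalisations fix it on all others. *)
Lemma on_nonneg_setT nu : on_nonneg nu -> nu [set 0%R] = 0 ->
  forall B : set (measurableTypeR R), measurable B ->
  nu B = nu (B `&` `]0%R, +oo[%classic).
Proof.
move=> nu0 nu1 B mB.
rewrite [in LHS](_ : B = (B `&` `]0%R, +oo[) `|` (B `&` `]-oo, 0%R])); last first.
  rewrite -setIUr; apply/seteqP; split=> [x Bx|x []//]; split => //=.
  by rewrite !in_itv/= andbT; case: (ltP 0%R x) => h; [left|right].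
have m1 : measurable (B `&` `]0%R, +oo[ : set (measurableTypeR R)).
  exact: measurableI.
have m2 : measurable (B `&` `]-oo, 0%R] : set (measurableTypeR R)).
  exact: measurableI.
rewrite measureU//; last first.
  apply/seteqP; split => // x [[_ /=]] + [_ /=]; rewrite !in_itv/= andbT.
  by move=> /lt_le_trans /[apply]; rewrite ltxx.
rewrite [X in _ + X](_ : _ = 0) ?adde0//.
apply/eqP; rewrite eq_le measure_ge0 andbT.
apply: (@le_trans _ _ (nu (`]-oo, 0%R[%classic `|` [set 0%R]))).
  apply: le_measure; rewrite ?inE//; first exact: measurableU.
  move=> x [_ /=]; rewrite !in_itv/= le_eqVlt => /predU1P[->|x0]; [by right|by left].
apply: le_trans (measureU2 _ _ _) _ => //.
by rewrite [X in X + _]nu0 [X in _ + X]nu1 adde0.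
Qed.

Lemma ge0_integral_split3 (m : {measure set (measurableTypeR R) -> \bar R})
  (g : R -> \bar R) (x : R) : (0 <= x)%R ->
  measurable_fun [set: R] g -> (forall y, 0 <= g y) ->
  \int[m]_(s in `]-oo, 0%R[) g s < +oo -> \int[m]_(s in `[0%R, x[) g s < +oo ->
  \int[m]_(s in `[x, +oo[) g s < +oo -> \int[m]_s g s < +oo.
Proof.
move=> x0 mg g0 h1 h2 h3.
have -> : [set: R] = `]-oo, 0%R[ `|` (`[0%R, x[ `|` `[x, +oo[).
  apply/seteqP; split => // y _; rewrite /= !in_itv/= andbT.
  case: (ltP y 0%R) => [|y0]; first by left.
  by right; case: (ltP y x) => yx; [left|right].
rewrite ge0_integral_setU//=.
- rewrite ge0_integral_setU//=.
  + by rewrite lte_add_pinfty// lte_add_pinfty.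
  + exact: measurable_funTS.
  + apply/disj_set2P/seteqP; split => // y []/=; rewrite !in_itv/= andbT.
    by move=> /andP[_ /lt_le_trans] /[apply]; rewrite ltxx.
- exact: measurableU.
- exact: measurable_funTS.
- apply/disj_set2P/seteqP; split => // y []/=; rewrite !in_itv/= andbT.
  move=> y0 [/andP[]|]; first by rewrite leNgt y0.
  by move=> /(le_trans x0); rewrite leNgt y0.
Qed.

End dictionary.

(** * The mapping takes values in S_0 *)

Section totality.
Context {R : realType}.
Notation mu := (@lebesgue_measure R).
Implicit Types (u f w : R -> R) (m ups nu : borel_measure R).
Local Open Scope ereal_scope.

Lemma measurable_sumH1 u : H1loc u ->
  measurable_fun [set: R] (fun x => u x + derive1 u x)%R.
Proof.
move=> uH; apply: measurable_funD; first exact: H1loc_measurable.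
exact: H1loc_measurable_derive.
Qed.

Lemma sqrD_le (a b : R) : ((a + b) ^+ 2 <= 2 * (a ^+ 2 + b ^+ 2))%R.
Proof. by have := sqr_ge0 (a - b)%R; rewrite !expr2; lra. Qed.

Lemma measurable_weighted f : measurable_fun [set: R] f ->
  measurable_fun [set: R] (fun s => (expR (- s) * f s)%:E).
Proof.
move=> mf; apply/measurable_EFinP; apply: measurable_funM => //.
exact: measurable_expRN.
Qed.

(** Three sources of finiteness: the first condition on []-oo, 0[], the finite limit superior on a
    ray [[x, +oo[], and the finite energy and local finiteness on [[0, x[]. *)
Lemma set_D_finite u m ups : H1loc u -> locally_finite m -> is_upsilon u m ups ->
  \int[mu]_(s in `]-oo, 0%R[) (expR (- s) * (u s ^+ 2 + derive1 u s ^+ 2))%:E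
    + \int[ups]_(s in `]-oo, 0%R[) (expR (- s))%:E < +oo ->
  limf_esup (fun x : R => (expR x)%:E *
                (\int[mu]_(s in `[x, +oo[)
                     (expR (- s) * (u s + derive1 u s) ^+ 2)%:E
                 + \int[ups]_(s in `[x, +oo[) (expR (- s))%:E))
               (pinfty_nbhs R) < +oo ->
  \int[mu]_s (expR (- s) * (u s + derive1 u s) ^+ 2)%:E < +oo /\
  \int[ups]_s (expR (- s))%:E < +oo.
Proof.
move=> uH mfin isU fin0 /limf_esup_pinfty_ltyP[M [C MC]].
have mf := measurable_sumH1 uH.
have mf2 : measurable_fun [set: R]
    (fun s => (expR (- s) * (u s + derive1 u s) ^+ 2)%:E).
  by apply: measurable_weighted; exact: measurable_funX.
have f20 s : 0 <= (expR (- s) * (u s + derive1 u s) ^+ 2)%:E.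
  by rewrite lee_fin mulr_ge0 ?expR_ge0 ?sqr_ge0.
have me := measurable_energy uH.
have me2 := measurable_weighted me.
have e20 s : 0 <= (expR (- s) * (u s ^+ 2 + derive1 u s ^+ 2))%:E.
  by rewrite lee_fin mulr_ge0 ?expR_ge0// addr_ge0// sqr_ge0.
have mN : measurable_fun [set: R] (fun s : R => (expR (- s))%:E).
  by apply/measurable_EFinP; exact: measurable_expRN.
have N0 s : 0 <= (expR (- s) : R)%:E by rewrite lee_fin expR_ge0.
(* Beyond both 0 and the threshold [M] from which the limit superior gives a bound. *)
pose x := (Num.max 0 M + 1)%R.
have x0 : (0 <= x)%R by rewrite addr_ge0// le_max lexx.
have Mx : (M < x)%R.
  by rewrite (@le_lt_trans _ _ (Num.max 0 M)%R)// ?le_max ?lexx ?orbT// ltrDl.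
have ray : \int[mu]_(s in `[x, +oo[) (expR (- s) * (u s + derive1 u s) ^+ 2)%:E
    + \int[ups]_(s in `[x, +oo[) (expR (- s))%:E < +oo.
  have := MC x Mx; rewrite muleC -lee_pdivlMr ?expR_gt0// => /le_lt_trans; apply.
  by rewrite -EFinM ltry.
have i0 A : 0 <= \int[mu]_(s in A) (expR (- s) * (u s + derive1 u s) ^+ 2)%:E.
  by apply: integral_ge0 => s _.
have j0 A : 0 <= \int[ups]_(s in A) (expR (- s))%:E.
  by apply: integral_ge0 => s _.
have k0 A : 0 <= \int[mu]_(s in A) (expR (- s) * (u s ^+ 2 + derive1 u s ^+ 2))%:E.
  by apply: integral_ge0 => s _.
have le2 A : measurable A ->
    \int[mu]_(s in A) (expR (- s) * (u s + derive1 u s) ^+ 2)%:E <=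
    2%:E * \int[mu]_(s in A) (expR (- s) * (u s ^+ 2 + derive1 u s ^+ 2))%:E.
  move=> mA; rewrite -ge0_integralZl//; last exact: measurable_funTS.
  apply: ge0_le_integral => //.
  - exact: measurable_funTS.
  - by apply: measurable_funeM; exact: measurable_funTS.
  - move=> s _; rewrite -EFinM lee_fin [leRHS]mulrCA ler_wpM2l ?expR_ge0//.
    exact: sqrD_le.
split; apply: (ge0_integral_split3 x0) => //.
- apply: le_lt_trans (le2 _ _) _ => //; rewrite lte_mul_pinfty//.
  by apply: le_lt_trans fin0; rewrite leeDl.
- apply: le_lt_trans (le2 _ _) _ => //; rewrite lte_mul_pinfty//.
  apply: le_lt_trans (energy_itv_lty 0%R x uH).
  apply: (@le_trans _ _ (energy u `[0%R, x[%classic)).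
    apply: ge0_le_integral => //.
    - exact: measurable_funTS.
    - by apply/measurable_EFinP; exact: measurable_funTS.
    - move=> s; rewrite /= in_itv/= => /andP[s0 _].
      rewrite lee_fin ler_piMl ?addr_ge0 ?sqr_ge0//.
      by rewrite -[leRHS]expR0 ler_expR oppr_le0.
  apply: ge0_subset_integral => //.
  - by apply/measurable_EFinP; exact: measurable_funTS.
  - by move=> s _; rewrite lee_fin addr_ge0// sqr_ge0.
  - exact: subset_itv_co_cc.
- by apply: le_lt_trans ray; rewrite leeDl.
- by apply: le_lt_trans fin0; rewrite leeDr.
- apply: (@le_lt_trans _ _ (\int[ups]_(s in `[0%R, x[) 1)).
    apply: ge0_le_integral => //.
    - exact: measurable_funTS.
    - move=> s; rewrite /= in_itv/= => /andP[s0 _].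
      by rewrite lee_fin -[leRHS]expR0 ler_expR oppr_le0.
  rewrite integral_cst// mul1e.
  apply: (@le_lt_trans _ _ (m `[0%R, x]%classic)); last first.
    by apply: mfin; exact: segment_compact.
  apply: (@le_trans _ _ (m `[0%R, x[%classic)).
    exact: (upsilon_le isU).
  by apply: le_measure; rewrite ?inE//; exact: subset_itv_co_cc.
- by apply: le_lt_trans ray; rewrite leeDr.
Qed.

Lemma transform_total (a : (R -> R) * borel_measure R) : set_D a ->
  exists2 b, set_S0 b & transform a b.
Proof.
case: a => u m [uH mfin eLe [ups [isU fin0 lsup]]].
have [fin1 fin2] := set_D_finite uH mfin isU fin0 lsup.
pose f x := (u x + derive1 u x)%R.
have mf : measurable_fun [set: R] f := measurable_sumH1 uH.
pose w x := (- (f (ln x) / x))%R.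
have mw : measurable_fun (`]0%R, +oo[%classic : set R) w.
  have mG : measurable_fun [set: R] (fun x => - (f x * expR (- x)))%R.
    apply: measurableT_comp => //; apply: measurable_funM => //.
    exact: measurable_expRN.
  apply: (@eq_measurable_fun _ _ _ _ _ ((fun x => - (f x * expR (- x)))%R \o (@ln R))).
    move=> y /set_mem; rewrite /= in_itv/= andbT => y0.
    by rewrite /w expRN lnK.
  by apply: measurable_funTS; apply: (measurableT_comp mG); exact: measurable_ln.
have wf : ae_eq mu (`]0%R, +oo[%classic : set R) w (fun y => - (f (ln y) / y))%R.
  by apply: aeW.
(* Since [expR] takes only positive values, no mass reaches 0 or the negative half-line. *)
pose nu : borel_measure R := @transport _ _ (measurableTypeR R) (measurableTypeR R) R
  ups (@expR R) _ (@measurable_expR R) (@measurable_expRN R) (fun x => expR_ge0 (- x)).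
have nuE B : nu B = \int[ups]_(x in (@expR R) @^-1` B) (expR (- x))%:E by [].
have Hnu : pushes_to ups nu.
  move=> B mB B0; rewrite nuE; congr (integral _ _ _).
  apply/seteqP; split=> [x /= Bx|x /= [y By <-]].
    by exists (expR x) => //; rewrite expRK.
  by have := B0 _ By; rewrite /= in_itv/= andbT => y0; rewrite lnK.
have nu1 : on_nonneg nu.
  rewrite /on_nonneg nuE (_ : _ @^-1` _ = set0) ?integral_set0//.
  by apply/seteqP; split => // x /=; rewrite in_itv/= ltNge expR_ge0.
have nu2 : nu [set 0%R] = 0.
  rewrite nuE (_ : _ @^-1` _ = set0) ?integral_set0//.
  by apply/seteqP; split => // x /= /eqP; rewrite gt_eqF ?expR_gt0.
exists (w, nu); last by split => //; exists ups.
split => //.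
- split => //.
  by rewrite -exp_of_setT (integral_sqr_transform mf mw wf).
- exact/(pushes_to_limsup mf mw wf Hnu).
Qed.

End totality.

(** * Well-definedness and injectivity *)

Section injectivity.
Context {R : realType}.
Notation mu := (@lebesgue_measure R).
Implicit Types (u f w : R -> R) (m ups nu : borel_measure R).
Local Open Scope ereal_scope.

Lemma transform_well_defined (a a' b b' : (R -> R) * borel_measure R) :
  set_D a -> set_D a' -> transform a b -> transform a' b' ->
  eq_D a a' -> eq_S0 b b'.
Proof.
case: a a' b b' => [u m] [u' m'] [w nu] [w' nu'] [uH _ _ _] _.
move=> [wE nu1 nu2 [ups isU H]] [wE' nu1' nu2' [ups' isU' H']] [/= uu' mm'].
subst u'; split => /=.
  by move: wE wE'; apply: filterS2 => y wy wy' y0; rewrite wy// wy'.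
have uu := upsilon_unique uH mm' isU isU'.
move=> B mB; rewrite (on_nonneg_setT nu1 nu2)// (on_nonneg_setT nu1' nu2')//.
have mB' : measurable (B `&` `]0%R, +oo[ : set (measurableTypeR R)).
  exact: measurableI.
rewrite H// H'//.
by apply: eq_measure_integral => A mA _; exact: uu.
Qed.

(** [nu] determines the measure with density [expR (- x)] with respect to [ups]; multiplying by the
    reciprocal density [expR] recovers [ups]. *)
Lemma upsilon_from_nu ups ups' nu nu' : pushes_to ups nu -> pushes_to ups' nu' ->
  eq_borel nu nu' -> eq_borel ups ups'.
Proof.
move=> H H' nn' B mB.
pose T (v : borel_measure R) : borel_measure R :=
  @transport _ _ (measurableTypeR R) (measurableTypeR R) R
  v id _ (@measurable_id _ (measurableTypeR R) setT) (@measurable_expRN R)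
  (fun x => expR_ge0 (- x)).
have TE (v : borel_measure R) : v B = \int[T v]_(x in B) (expR x)%:E.
  rewrite integral_transport//; last first.
    by apply/measurable_EFinP; exact: measurable_expR.
  under eq_integral do rewrite -EFinM -expRD subrr expR0.
  by rewrite integral_cst// mul1e.
rewrite !TE; apply: eq_measure_integral => A mA _.
transitivity (\int[ups]_(s in A) (expR (- s))%:E) => //.
rewrite -(pushes_toE H)// nn' ?(pushes_toE H')//.
exact: measurable_exp_of.
Qed.

(** [expR] is the integrating factor of [u + u']. The identity serves uniqueness, the equation for
    the constructed solution, and the derivative of [phi]. *)
Lemma derive_expRM u (x : R) : derivable u x 1%R ->
  derive1 (fun y => expR y * u y)%R x = (expR x * (u x + derive1 u x))%R.
Proof.
move=> du; have idu := derivable_is_derive1 du.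
have [_] := @is_deriveM _ _ (@expR R) u x 1%R _ _ (is_derive_expR x) idu.
by move=> h; rewrite derive1E [LHS]h /GRing.scale/= mulrDr addrC (mulrC (u x)).
Qed.

(** The difference times [expR] has derivative zero almost everywhere, and absolute continuity makes
    it constant. *)
Lemma solution_homogeneous u u' : loc_absolutely_continuous u ->
  loc_absolutely_continuous u' ->
  {ae mu, forall x, u x + derive1 u x = u' x + derive1 u' x}%R ->
  exists c : R, forall x, (u x - u' x = c * expR (- x))%R.
Proof.
move=> uac uac' uu'.
pose d x := (u x - u' x)%R; pose h x := (expR x * d x)%R.
have dh : {ae mu, forall x, derive1 h x = 0%R}.
  have := loc_ac_derivable uac; have := loc_ac_derivable uac'.
  move: uu'; apply: filterS3; first exact: (ae_filter_ringOfSetsType mu).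
  move=> x uu' du' du.
  have [dd dE] := is_deriveB (derivable_is_derive1 du) (derivable_is_derive1 du').
  rewrite derive_expRM// derive1E [X in (_ + X)%R]dE.
  rewrite (_ : _ + _ = 0)%R ?mulr0//.
  by rewrite /d addrACA -opprD uu' subrr.
have hE a b : (a < b)%R -> h b = h a.
  move=> ab; apply: ac_derive0; first exact: ltW.
    by apply: acM; [exact: ac_expR|apply: acB; [exact: uac|exact: uac']].
  by move: dh; apply: filterS; [exact: (ae_filter_ringOfSetsType mu)|move=> x ->].
exists (h 0%R) => x.
have -> : h 0%R = h x by case: (ltgtP x 0%R) => [/hE//|/hE//|->].
by rewrite /h mulrAC -expRD subrr expR0 mul1r.
Qed.

Lemma set_D_left_finite u m : set_D (u, m) ->
  \int[mu]_(s in `]-oo, 0%R[) (expR (- s) * u s ^+ 2)%:E < +oo.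
Proof.
move=> [uH _ _ [ups [_ fin0 _]]].
apply: le_lt_trans fin0; apply: (@le_trans _ _ (\int[mu]_(s in `]-oo, 0%R[)
    (expR (- s) * (u s ^+ 2 + derive1 u s ^+ 2))%:E)); last first.
  by rewrite leeDl//; apply: integral_ge0 => s _; rewrite lee_fin expR_ge0.
apply: ge0_le_integral => //.
- by move=> s _; rewrite lee_fin mulr_ge0 ?expR_ge0 ?sqr_ge0.
- apply: measurable_funTS; apply: measurable_weighted; apply: measurable_funX.
  exact: H1loc_measurable.
- apply: measurable_funTS; apply: measurable_weighted; exact: measurable_energy.
- by move=> s _; rewrite lee_fin ler_wpM2l ?expR_ge0// lerDl sqr_ge0.
Qed.

Lemma set_D_inj u u' m m' : set_D (u, m) -> set_D (u', m') ->
  {ae mu, forall x, u x + derive1 u x = u' x + derive1 u' x}%R -> u = u'.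
Proof.
move=> D D' uu'; have [uH _ _ _] := D; have [uH' _ _ _] := D'.
have [c cE] := solution_homogeneous uH.1 uH'.1 uu'.
suff c0 : c = 0%R by apply/funext => x; apply/eqP; rewrite -subr_eq0 cE c0 mul0r.
apply/eqP; rewrite -sqrf_eq0; apply/negP => /negP c0.
have c2 : (0 < c ^+ 2)%R by rewrite lt_neqAle eq_sym c0 sqr_ge0.
have h1 := set_D_left_finite D; have h2 := set_D_left_finite D'.
have mw (v : R -> R) : H1loc v ->
    measurable_fun (`]-oo, 0%R[ : set R) (fun s => (expR (- s) * v s ^+ 2)%:E).
  move=> vH; apply: measurable_funTS; apply: measurable_weighted.
  by apply: measurable_funX; exact: H1loc_measurable.
(* For [s < 0] both exponentials are at least 1, so [c ^+ 2] is at most [(u s - u' s) ^+ 2], hence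
   at most [2 * expR (- s) * (u s ^+ 2 + u' s ^+ 2)]. After division by [c ^+ 2] this finite
   quantity would dominate the length of the half-line. *)
have : (2 * c ^- 2)%:E * (\int[mu]_(s in `]-oo, 0%R[) (expR (- s) * u s ^+ 2)%:E +
         \int[mu]_(s in `]-oo, 0%R[) (expR (- s) * u' s ^+ 2)%:E) < +oo.
  apply: lte_mul_pinfty => //; last exact: lte_add_pinfty.
  by rewrite lee_fin mulr_ge0// invr_ge0 ltW.
apply/negP; rewrite -leNgt leye_eq; apply/eqP.
have v0 (v : R -> R) s : 0 <= (expR (- s) * v s ^+ 2)%:E.
  by rewrite lee_fin mulr_ge0 ?expR_ge0 ?sqr_ge0.
rewrite -ge0_integralD//; [|exact: mw|exact: mw].
rewrite -ge0_integralZl//; last 3 first.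
- by apply: emeasurable_funD; exact: mw.
- by move=> s _; rewrite adde_ge0.
- by rewrite lee_fin mulr_ge0// invr_ge0 ltW.
apply/eqP; rewrite -leye_eq.
have -> : +oo = mu (`]-oo, 0%R[%classic : set R).
  by rewrite lebesgue_measure_itv/= ltNyr.
rewrite -[leLHS]mul1e -integral_cst//.
apply: ge0_le_integral => //.
- by apply: measurable_funeM; apply: emeasurable_funD; exact: mw.
- move=> s; rewrite /= in_itv/= => s0; rewrite -EFinD -EFinM lee_fin.
  rewrite mulrAC ler_pdivlMr// mul1r.
  have e1 : (1 <= expR (- s) :> R)%R by rewrite -expR0 ler_expR oppr_ge0 ltW.
  have e0 := expR_ge0 (- s)%R.
  have k1 : ((u s - u' s) ^+ 2 <= 2 * (u s ^+ 2 + u' s ^+ 2))%R.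
    by have := sqrD_le (u s) (- u' s)%R; rewrite sqrrN.
  have k2 : (c ^+ 2 <= (u s - u' s) ^+ 2)%R.
    by rewrite cE exprMn ler_peMr ?sqr_ge0// exprn_ege1.
  rewrite (le_trans k2)// (le_trans k1)// ler_wpM2l//.
  by rewrite lerD// ler_peMl// sqr_ge0.
Qed.

Lemma transform_injective (a a' b b' : (R -> R) * borel_measure R) :
  set_D a -> set_D a' -> transform a b -> transform a' b' ->
  eq_S0 b b' -> eq_D a a'.
Proof.
case: a a' b b' => [u m] [u' m'] [w nu] [w' nu'] D D'.
move=> [wE nu1 nu2 [ups isU H]] [wE' nu1' nu2' [ups' isU' H']] [/= ww' nn'].
have uu' : u = u'.
  apply: (set_D_inj D D').
  suff : {ae mu, forall y, (0 < y)%R -> u (ln y) + derive1 u (ln y) =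
      u' (ln y) + derive1 u' (ln y)}%R.
    move=> /ae_expR; apply: filterS; first exact: (ae_filter_ringOfSetsType mu).
    by move=> x; rewrite expRK.
  move: ww' wE wE'; apply: filterS3 => y ww' wE wE' y0.
  have y0' : (`]0%R, +oo[%classic : set R) y by rewrite /= in_itv/= y0.
  have yi : (y^-1 != 0)%R by rewrite invr_neq0// gt_eqF.
  apply: (mulIf yi); apply: oppr_inj.
  by rewrite -(wE y0') -(wE' y0') (ww' y0').
split; first exact: uu'.
move=> B mB; transitivity (ups B + energy u B); first exact: isU.
rewrite (upsilon_from_nu H H' nn' mB) uu'.
exact/esym/isU'.
Qed.

End injectivity.

(** * The equation u + u' = f *)

Section first_order_equation.
Context {R : realType}.
Notation mu := (@lebesgue_measure R).
Implicit Types (a b x y s : R).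
Context (f : R -> R) (mf : measurable_fun [set: R] f).
Context (fin : (\int[mu]_s (expR (- s) * f s ^+ 2)%:E < +oo)%E).

Let W := fine (\int[mu]_s (expR (- s) * f s ^+ 2)%:E)%E.
Let g s := expR s * f s.

Let k0 s : (0 <= (expR (- s) * f s ^+ 2)%:E)%E.
Proof. by rewrite lee_fin mulr_ge0 ?expR_ge0 ?sqr_ge0. Qed.

Let mk : measurable_fun [set: R] (fun s => (expR (- s) * f s ^+ 2)%:E).
Proof. by apply: measurable_weighted; exact: measurable_funX. Qed.

Let mg : measurable_fun [set: R] g.
Proof. by apply: measurable_funM => //; exact: measurable_expR. Qed.

Let W0 : 0 <= W.
Proof. by rewrite fine_ge0// integral_ge0. Qed.

Let WE : (\int[mu]_s (expR (- s) * f s ^+ 2)%:E = W%:E)%E.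
Proof. by rewrite fineK// ge0_fin_numE// integral_ge0. Qed.

Let le_W (A : set R) : measurable A ->
  (\int[mu]_(s in A) (expR (- s) * f s ^+ 2)%:E <= W%:E)%E.
Proof. by move=> mA; rewrite -WE; exact: ge0_subset_integral. Qed.

(** By substitution the integral is the length of []0, expR a]]. *)
Lemma integral_expR_ray a : (\int[mu]_(s in `]-oo, a]) (expR s)%:E = (expR a)%:E)%E.
Proof.
rewrite lebesgue_expR_ln// (_ : _ `&` _ = `]0, expR a]%classic).
  by rewrite lebesgue_measure_itv/= lte_fin expR_gt0 oppr0 adde0.
apply/seteqP; split=> y /=; rewrite !in_itv/= ?andbT.
  by move=> [y0]; rewrite -ler_expR lnK// y0.
by move=> /andP[y0 ya]; split => //; rewrite -ler_expR lnK.
Qed.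

(* AM-GM; [v_bound] uses the weight [l = expR (a / 2)]. *)
Let integral_norm_le a (l : R) : 0 < l ->
  (\int[mu]_(s in `]-oo, a]) `|g s|%:E <=
   (l / 2 * expR a + l^-1 / 2 * expR (2 * a) * W)%:E)%E.
Proof.
move=> l0.
have c0 : 0 <= l / 2 by rewrite divr_ge0// ltW.
have d0 : 0 <= l^-1 / 2 * expR (2 * a).
  by rewrite mulr_ge0 ?expR_ge0// divr_ge0// invr_ge0 ltW.
apply: (@le_trans _ _ (\int[mu]_(s in `]-oo, a]) ((l / 2)%:E * (expR s)%:E +
   (l^-1 / 2 * expR (2 * a))%:E * (expR (- s) * f s ^+ 2)%:E))%E).
  apply: ge0_le_integral => //.
  - by apply/measurable_EFinP/measurable_funTS; exact: measurableT_comp.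
  - apply: emeasurable_funD; apply: measurable_funeM.
      by apply/measurable_EFinP/measurable_funTS; exact: measurable_expR.
    exact: measurable_funTS.
  - move=> s; rewrite /= in_itv/= => sa.
    rewrite -!EFinM -EFinD lee_fin /g normrM (ger0_norm (expR_ge0 s)).
    have amgm : `|f s| <= l / 2 + l^-1 / 2 * f s ^+ 2.
      have li0 : 0 <= l^-1 / 2 by rewrite divr_ge0// invr_ge0 ltW.
      have := mulr_ge0 li0 (sqr_ge0 (`|f s| - l)).
      rewrite sqrrB real_normK ?num_real// => h.
      rewrite -subr_ge0; apply: le_trans h _.
      rewrite le_eqVlt; apply/orP; left; apply/eqP.
      by field; rewrite gt_eqF.
    apply: le_trans (ler_wpM2l (expR_ge0 s) amgm) _.
    (* [expR s] equals [expR (2 * s) * expR (- s)] and [s <= a]; this brings in the weight of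
       [W]. *)
    have h : expR s <= expR (2 * a) * expR (- s).
      by rewrite -expRD ler_expR; lra.
    have q0 : 0 <= l^-1 / 2 * f s ^+ 2.
      by rewrite mulr_ge0 ?sqr_ge0// divr_ge0// invr_ge0 ltW.
    rewrite mulrDr lerD//; first by rewrite mulrC.
    rewrite mulrC (le_trans (ler_wpM2l q0 h))// le_eqVlt; apply/orP; left.
    by apply/eqP; ring.
have me : measurable_fun (`]-oo, a] : set R) (fun s => (expR s)%:E).
  by apply/measurable_EFinP/measurable_funTS; exact: measurable_expR.
have mkA : measurable_fun (`]-oo, a] : set R) (fun s => (expR (- s) * f s ^+ 2)%:E).
  exact: measurable_funTS.
rewrite ge0_integralD//; [|by move=> s _; apply: mule_ge0; rewrite lee_fin ?expR_ge0|
  exact: measurable_funeM|by move=> s _; apply: mule_ge0|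
  exact: measurable_funeM].
rewrite !ge0_integralZl//.
rewrite integral_expR_ray EFinD !EFinM leeD2l// lee_wpmul2l//.
exact: le_W.
Qed.

Let ig a : mu.-integrable `]-oo, a] (EFin \o g).
Proof.
apply/integrableP; split.
  by apply/measurable_EFinP/measurable_funTS.
by apply: le_lt_trans (integral_norm_le a ltr01) _; rewrite ltry.
Qed.

Let v x := (\int[mu]_(s in `]-oo, x]) g s)%R.
Let u x := expR (- x) * v x.

Let vE x : v x = expR x * u x.
Proof. by rewrite /u mulrA -expRD subrr expR0 mul1r. Qed.

(** The weight balances both terms of AM-GM at the rate [expR (3 * x / 2)]. Thus [u x] is at most of
    order [expR (x / 2)], exactly what bounds [phi]. *)
Let v_bound x : `|v x| <= expR (x / 2) * expR x * (1 + W) / 2.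
Proof.
apply: le_trans (le_normr_Rintegral _ (ig x)) _ => //.
have h := integral_norm_le x (expR_gt0 (x / 2)).
rewrite -lee_fin fineK; last first.
  by apply: integrable_fin_num => //; exact: integrable_norm (ig x).
apply: le_trans h _; rewrite lee_fin -expRN.
have -> : expR (- (x / 2)) / 2 * expR (2 * x) = expR (x / 2) * expR x / 2.
  by rewrite mulrAC -!expRD; congr (expR _ / 2); field.
by rewrite le_eqVlt; apply/orP; left; apply/eqP; ring.
Qed.

Let vac a b : absolutely_continuous a b v.
Proof.
apply: (@ac_le_integral R a b v g).
  by apply: integrableS (ig b) => //; exact: subset_itvr.
move=> x y _ xy _; rewrite /v (Rintegral_itvB (ig y))//.
have iS : mu.-integrable `[x, y] (EFin \o g).
  by apply: integrableS (ig y) => //; exact: subset_itvr.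
have iS' : mu.-integrable `]x, y] (EFin \o g).
  by apply: integrableS (ig y) => //; exact: subset_itvr.
rewrite Rintegral_itv_obnd_cbnd//.
apply: (@le_trans _ _ (\int[mu]_(t in `[x, y]) `|g t|)%R%:E).
  by rewrite lee_fin le_normr_Rintegral.
by rewrite fineK//; apply: integrable_fin_num => //; exact: integrable_norm iS.
Qed.

Let uac : loc_absolutely_continuous u.
Proof. by move=> a b _; apply: acM; [exact: ac_expRN|exact: vac]. Qed.

Let uf : {ae mu, forall x, u x + derive1 u x = f x}.
Proof.
have locg : locally_integrable [set: R] g.
  split => //; first exact: openT.
  move=> K _ cK; have [n Kn] := compact_sub_itv cK.
  have /integrableP[_] := ig n%:R.
  apply: le_lt_trans; apply: ge0_subset_integral => //.
  - exact: compact_measurable.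
  - by apply/measurable_EFinP/measurable_funTS; exact: measurableT_comp.
  - move=> x /Kn/=; rewrite !in_itv/= => /andP[_ ->]//.
have := FTC1Ny ig locg; have := loc_ac_derivable uac.
apply: filterS2; first exact: (ae_filter_ringOfSetsType mu).
move=> x du [_]; rewrite -/v (funext vE) derive_expRM// /g.
by move=> /mulfI; apply; rewrite gt_eqF// expR_gt0.
Qed.

Let cu : continuous u.
Proof. exact: loc_ac_continuous. Qed.

Let mu1 : measurable_fun [set: R] u.
Proof. exact: continuous_measurable_fun. Qed.

Let mdu : measurable_fun [set: R] (derive1 u).
Proof. exact: measurable_derive1. Qed.

(** Almost everywhere [derive1 u] is [f - u]: [f] is locally square integrable because [expR (- x)]
    is at least [expR (- r)] for [x <= r], and [u] is continuous. *)
Let derive1_sqr_lty (K : set R) : compact K ->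
  (\int[mu]_(x in K) (derive1 u x ^+ 2)%:E < +oo)%E.
Proof.
move=> cK; have [n] := compact_sub_itv cK.
set l := (- n%:R)%R; set r := n%:R => Kn.
have mdu2 : measurable_fun [set: R] (fun x => (derive1 u x ^+ 2)%:E).
  by apply/measurable_EFinP; exact: measurable_funX.
apply: (@le_lt_trans _ _ (\int[mu]_(x in `[l, r]) (derive1 u x ^+ 2)%:E)%E).
  apply: ge0_subset_integral => //; first exact: compact_measurable.
    exact: measurable_funTS.
  by move=> x _; rewrite lee_fin sqr_ge0.
rewrite (@ae_eq_integral _ _ _ mu _ (fun x => ((f x - u x) ^+ 2)%:E))//; last 3 first.
- exact: measurable_funTS.
- apply: measurable_funTS; apply/measurable_EFinP; apply: measurable_funX.
  exact: measurable_funB.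
- move: uf; apply: filterS; first exact: (ae_filter_ringOfSetsType mu).
  by move=> x <- _; rewrite addrAC subrr add0r.
apply: (@le_lt_trans _ _ (\int[mu]_(x in `[l, r])
  ((2 * expR r)%:E * (expR (- x) * f x ^+ 2)%:E + 2%:E * (u x ^+ 2)%:E))%E).
  apply: ge0_le_integral => //.
  - by move=> x _; rewrite lee_fin sqr_ge0.
  - apply: measurable_funTS; apply/measurable_EFinP; apply: measurable_funX.
    exact: measurable_funB.
  - apply: emeasurable_funD; apply: measurable_funeM; apply: measurable_funTS => //.
    by apply/measurable_EFinP; exact: measurable_funX.
  - move=> x; rewrite /= in_itv/= => /andP[_ xn].
    rewrite -!EFinM -EFinD lee_fin.
    have := sqrD_le (f x) (- u x); rewrite sqrrN => /le_trans; apply.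
    rewrite mulrDr lerD2r -mulrA ler_wpM2l// mulrA ler_peMl ?sqr_ge0//.
    by rewrite -expRD -expR0 ler_expR subr_ge0.
have c0 : (0 <= (2 * expR r)%:E)%E by rewrite lee_fin mulr_ge0// expR_ge0.
have u0 x : (0 <= (u x ^+ 2)%:E)%E by rewrite lee_fin sqr_ge0.
have mkA : measurable_fun (`[l, r] : set R) (fun x => (expR (- x) * f x ^+ 2)%:E).
  exact: measurable_funTS.
have mu2 : measurable_fun (`[l, r] : set R) (fun x => (u x ^+ 2)%:E).
  by apply: measurable_funTS; apply/measurable_EFinP; exact: measurable_funX.
rewrite ge0_integralD//; [|by move=> x _; apply: mule_ge0|
  exact: measurable_funeM|by move=> x _; apply: mule_ge0|exact: measurable_funeM].
rewrite !ge0_integralZl//; apply: lte_add_pinfty; apply: lte_mul_pinfty => //.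
  by rewrite (le_lt_trans (le_W _))// ltry.
exact: continuous_sqr_itv_lty.
Qed.

Let uH : H1loc u.
Proof. by split; [exact: uac|split; [exact: mdu|exact: derive1_sqr_lty]]. Qed.

Let phi x := expR (- x) * (u x * u x).

Let phi_bound x : phi x <= ((1 + W) / 2) ^+ 2.
Proof.
have e2 : expR (- (x / 2)) * expR (- (x / 2)) = expR (- x).
  by rewrite -expRD; congr expR; field.
have -> : phi x = (expR (- (x / 2)) * `|u x|) ^+ 2.
  by rewrite exprMn real_normK ?num_real// /phi -e2 !expr2.
rewrite ler_sqr ?nnegrE ?mulr_ge0 ?expR_ge0 ?divr_ge0 ?addr_ge0//.
rewrite /u normrM (ger0_norm (expR_ge0 _)).
apply: le_trans (ler_wpM2l (expR_ge0 _) (ler_wpM2l (expR_ge0 _) (v_bound x))) _.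
rewrite [leLHS](_ : _ = (expR (- (x / 2)) * expR (x / 2)) *
  (expR (- x) * expR x) * ((1 + W) / 2)); last by ring.
have eN y : expR (- y) * expR y = 1 :> R by rewrite -expRD addNr expR0.
by rewrite !eN !mul1r.
Qed.

(** Derivability of [phi] stays a premise because [left_bound] obtains it together with the density
    of [phi]. *)
Let phi_derive : {ae mu, forall x, derivable phi x 1 ->
  expR (- x) * (2 * u x ^+ 2 + derive1 u x ^+ 2) =
  expR (- x) * f x ^+ 2 - derive1 phi x}.
Proof.
have := loc_ac_derivable uac; move: uf; apply: filterS2.
  exact: (ae_filter_ringOfSetsType mu).
move=> x <- du dphi.
(* [phi = exp (- x) * (u * u)] is differentiated through [exp x * phi x]. *)
have := derive_expRM dphi.
have -> : (fun y => expR y * phi y) = (u * u)%R.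
  by apply/funext => y; rewrite /phi mulrA -expRD subrr expR0 mul1r.
have D := derivable_is_derive1 du.
have duu : derive1 (u * u) x = u x * derive1 u x + u x * derive1 u x.
  by rewrite derive1E; have [_ ->] := is_deriveM D D.
rewrite duu => /(congr1 ( *%R (expR (- x)))).
rewrite [RHS]mulrA -expRD addNr expR0 mul1r => h.
have {}h : derive1 phi x =
  expR (- x) * (u x * derive1 u x + u x * derive1 u x) - expR (- x) * (u x * u x).
  by rewrite h -/(phi x) addrAC subrr add0r.
by rewrite h; ring.
Qed.

(** The bound is uniform in [a]: the weighted integral of [f ^+ 2] is at most [W], and the boundary
    contribution [phi a - phi 0] is at most [phi a], to which [phi_bound] applies. *)
Let left_bound a : a < 0 ->
  (\int[mu]_(s in `]a, 0%R[) (expR (- s) * (2 * u s ^+ 2 + derive1 u s ^+ 2))%:E <=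
   (W + ((1 + W) / 2) ^+ 2)%:E)%E.
Proof.
move=> a0.
have phiac : absolutely_continuous a 0 phi.
  by apply: acM; [exact: ac_expRN|apply: acM; exact: uac].
have [q [iq qE qphi]] := ac_ftc (ltW a0) phiac.
have mq : measurable_fun [set: R] (EFin \o q) by case/integrableP : iq.
have iqa : mu.-integrable `]a, 0[ (EFin \o q) by exact: integrableS iq.
have ik : mu.-integrable `]a, 0[ (EFin \o (fun s => expR (- s) * f s ^+ 2)).
  apply/integrableP; split; first exact: measurable_funTS.
  apply: le_lt_trans (ltry W); apply: le_trans (le_W (measurable_itv `]a, 0[)).
  rewrite le_eqVlt; apply/orP; left; apply/eqP; apply: eq_integral => s _.
  exact: (gee0_abs (k0 s)).
have mE : measurable_fun [set: R]
    (fun s => (expR (- s) * (2 * u s ^+ 2 + derive1 u s ^+ 2))%:E).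
  apply: measurable_weighted; apply: measurable_funD; last exact: measurable_funX.
  by apply: measurable_funM => //; exact: measurable_funX.
rewrite (@ae_eq_integral _ _ _ mu _ (fun s => (expR (- s) * f s ^+ 2 - q s)%:E))//;
  last 3 first.
- exact: measurable_funTS.
- by apply: (measurable_int mu); exact: integrableB ik iqa.
- move: phi_derive qphi; apply: filterS2; first exact: (ae_filter_ringOfSetsType mu).
  move=> s kE dE; rewrite /= in_itv/= => as0.
  by have [dphi <-] := dE as0; rewrite kE.
rewrite integralB_EFin//.
have -> : (\int[mu]_(s in `]a, 0%R[) (q s)%:E = (phi 0 - phi a)%:E)%E.
  rewrite qE ?(ltW a0)// /Rintegral fineK; last first.
    by apply: integrable_fin_num => //; exact: integrableS iq.
  rewrite integral_itv_bndo_bndc; last exact: measurable_funTS.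
  by rewrite integral_itv_obnd_cbnd//; exact: measurable_funTS.
apply: (@le_trans _ _ (W%:E - (phi 0 - phi a)%:E)%E).
  by rewrite leeB// le_W.
rewrite -EFinB lee_fin.
have p0 : 0 <= phi 0 by rewrite mulr_ge0 ?expR_ge0// -expr2 sqr_ge0.
by have := phi_bound a; lra.
Qed.

Let left_finite :
  (\int[mu]_(s in `]-oo, 0%R[) (expR (- s) * (u s ^+ 2 + derive1 u s ^+ 2))%:E < +oo)%E.
Proof.
have mE : measurable_fun [set: R]
    (fun s => (expR (- s) * (u s ^+ 2 + derive1 u s ^+ 2))%:E).
  by apply: measurable_weighted; exact: measurable_energy.
have E0 s : (0 <= (expR (- s) * (u s ^+ 2 + derive1 u s ^+ 2))%:E)%E.
  by rewrite lee_fin mulr_ge0 ?expR_ge0// addr_ge0// sqr_ge0.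
apply: (@le_lt_trans _ _ (W + ((1 + W) / 2) ^+ 2)%:E); last exact: ltry.
pose I (n : nat) : set R := `](- n%:R)%R, 0%R[%classic.
have -> : `]-oo, 0%R[%classic = \bigcup_n I n.
  apply/seteqP; split => s; rewrite /= in_itv/=.
    move=> s0; exists (Num.truncn `|s|).+1 => //; rewrite /I/= in_itv/= s0 andbT.
    by rewrite ltrNl (le_lt_trans (ler_norm _))// normrN truncnS_gt.
  by move=> [n _]; rewrite /I/= in_itv/= => /andP[].
have : (\int[mu]_(s in I n) (expR (- s) * (u s ^+ 2 + derive1 u s ^+ 2))%:E)%E
    @[n --> \oo] --> (\int[mu]_(s in \bigcup_n I n)
      (expR (- s) * (u s ^+ 2 + derive1 u s ^+ 2))%:E)%E.
  apply: ge0_nondecreasing_set_cvg_integral => //.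
  - move=> i j ij; apply/subsetPset => s; rewrite /I/= !in_itv/= => /andP[h ->].
    by rewrite andbT (le_lt_trans _ h)// lerN2 ler_nat.
  - by move=> n; exact: measurable_itv.
  - by move=> n; exact: measurable_funTS.
move=> cvgI; rewrite -(cvg_lim _ cvgI)//; apply: lime_le.
  by apply/cvg_ex; eexists; exact: cvgI.
(* For [n = 0] the interval is empty, while [left_bound] asks for a negative endpoint. *)
apply: nearW => -[|n].
  rewrite /I oppr0 set_itv_ge ?bnd_simp ?ltxx// integral_set0 lee_fin.
  by rewrite addr_ge0// sqr_ge0.
apply: le_trans (left_bound (_ : (- n.+1%:R)%R < 0)); last by rewrite oppr_lt0.
apply: ge0_le_integral => //.
- exact: measurable_itv.
- exact: measurable_funTS.
- apply: measurable_funTS; apply: measurable_weighted.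
  apply: measurable_funD; last exact: measurable_funX.
  by apply: measurable_funM => //; exact: measurable_funX.
- move=> s _; rewrite lee_fin ler_wpM2l ?expR_ge0// lerD2r.
  by rewrite ler_peMl ?sqr_ge0// ler1n.
Qed.

Lemma first_order_solution : exists u : R -> R, [/\ H1loc u,
  {ae mu, forall x, u x + derive1 u x = f x} &
  (\int[mu]_(s in `]-oo, 0%R[)
     (expR (- s) * (u s ^+ 2 + derive1 u s ^+ 2))%:E < +oo)%E].
Proof. by exists u. Qed.

End first_order_equation.

(** * Surjectivity *)

Section surjectivity.
Context {R : realType}.
Notation mu := (@lebesgue_measure R).
Implicit Types (u f w : R -> R) (m ups nu : borel_measure R).
Local Open Scope ereal_scope.

Let measurable_max0 : measurable_fun [set: R] (fun y : R => Num.max y 0%R).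
Proof. exact: measurable_maxr. Qed.

Let max0_ge0 (y : R) : (0 <= Num.max y 0)%R.
Proof. by rewrite le_max lexx orbT. Qed.

(** On the positive half-line the density [y] cancels [expR (- ln y)]. Over the preimage of
    [[-n, n]] the density is at most [expR n], so finiteness of [nu] gives local finiteness. *)
Lemma upsilon_of_nu nu : nu setT < +oo -> exists2 ups : borel_measure R,
  pushes_to ups nu & locally_finite ups.
Proof.
move=> nufin.
(* The density [max y 0] discards the half-line where [ln] is the default [0]. *)
pose ups : borel_measure R := @transport _ _ (measurableTypeR R) (measurableTypeR R) R
  nu (@ln R) _ (@measurable_ln R) measurable_max0 max0_ge0.
exists ups.
- move=> B mB B0.
  have BE : (@ln R) @` B = (@expR R) @^-1` B.
    apply/seteqP; split=> [x /= [y By <-]|x /= Bx].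
      by have := B0 _ By; rewrite /= in_itv/= andbT => y0; rewrite lnK.
    by exists (expR x) => //; rewrite expRK.
  have mlnB : measurable ((@ln R) @` B : set R).
    by rewrite BE -[X in measurable X]setTI; exact: measurable_expR.
  rewrite integral_transport//; last first.
    by apply/measurable_EFinP; exact: measurable_expRN.
  transitivity (\int[nu]_(y in (@ln R) @^-1` ((@ln R) @` B))
      (\1_(`]0%R, +oo[%classic : set R) y)%:E).
    rewrite integral_indic//; last exact: measurable_preimage_ln.
    congr (nu _); apply/seteqP; split=> y.
      by move=> By; split; [exact: B0|exists y].
    move=> [/=]; rewrite in_itv/= andbT => y0 [z Bz lnzy].
    have := B0 _ Bz; rewrite /= in_itv/= andbT => z0.
    by rewrite -(lnK y0) -lnzy lnK.
  apply: eq_integral => y _; rewrite indicE -EFinM; congr EFin.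
  have [y0|y0] := ltP 0%R y.
    by rewrite mem_set ?expRN ?lnK ?mulVf ?gt_eqF// /= in_itv/= y0.
  by rewrite memNset ?mulr0//= in_itv/= ltNge y0.
- apply: locally_finiteP => n.
  set A : set R := `[_, _]%classic.
  apply: (@le_lt_trans _ _ (\int[nu]_(y in (@ln R) @^-1` A) (expR n%:R)%:E)).
    apply: ge0_le_integral => //.
    + by apply: measurable_preimage_ln; exact: measurable_itv.
    + by move=> y _; rewrite lee_fin.
    + by apply/measurable_EFinP; apply: measurable_funTS.
    + move=> y; rewrite /A/= in_itv/= => /andP[_ yn].
      rewrite lee_fin ge_max expR_ge0 andbT.
      have [y0|y0] := ltP 0%R y; last exact: le_trans y0 (expR_ge0 _).
      by rewrite -(lnK y0) ler_expR.
  rewrite integral_cst//; last by apply: measurable_preimage_ln; exact: measurable_itv.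
  apply: lte_mul_pinfty => //.
  apply: le_lt_trans nufin; apply: le_measure; rewrite ?inE//.
  by apply: measurable_preimage_ln; exact: measurable_itv.
Qed.

Let energy_density_ge0 u (x : R) : (0 <= u x ^+ 2 + derive1 u x ^+ 2)%R.
Proof. by rewrite addr_ge0// sqr_ge0. Qed.

Lemma mu_of_upsilon u ups : H1loc u -> locally_finite ups ->
  exists m : borel_measure R, [/\ is_upsilon u m ups, locally_finite m &
    forall B : set (measurableTypeR R), measurable B -> energy u B <= m B].
Proof.
move=> uH upsfin.
pose en : borel_measure R := @transport _ _ (measurableTypeR R) (measurableTypeR R) R
  mu id _ (@measurable_id _ (measurableTypeR R) setT) (measurable_energy uH)
  (energy_density_ge0 u).
pose m : borel_measure R := measure_add ups en.
have mE B : m B = ups B + energy u B by exact: measure_addE.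
exists m; split.
- by move=> B _; exact: mE.
- apply: locally_finiteP => n; rewrite mE; apply: lte_add_pinfty.
    by apply: upsfin; exact: segment_compact.
  exact: energy_itv_lty.
- by move=> B mB; rewrite mE leeDr.
Qed.

Lemma transform_surjective (b : (R -> R) * borel_measure R) : set_S0 b ->
  exists2 a, set_D a & transform a b.
Proof.
case: b => w nu [[mw wfin] nu1 nufin nu2 lsup].
(* The formula for [w] solved for [u + u']. *)
pose f x := (- (expR x * w (expR x)))%R.
have mf : measurable_fun [set: R] f.
  apply: measurableT_comp => //; apply: measurable_funM; first exact: measurable_expR.
  apply: (@measurable_comp _ _ _ _ _ _ (`]0%R, +oo[%classic : set R) w) => //.
    by move=> _ [x _ <-]; rewrite /= in_itv/= expR_gt0.
have wf : ae_eq mu (`]0%R, +oo[%classic : set R) w (fun y => - (f (ln y) / y))%R.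
  apply: aeW => y; rewrite /= in_itv/= andbT => y0.
  by rewrite /f lnK// mulNr opprK mulrAC divff ?mul1r// gt_eqF.
have ffin : \int[mu]_s (expR (- s) * f s ^+ 2)%:E < +oo.
  by rewrite -(integral_sqr_transform mf mw wf)// exp_of_setT.
have [u [uH uf ufin]] := first_order_solution mf ffin.
have [ups Hups upsfin] := upsilon_of_nu nufin.
have [m [isU mfin mle]] := mu_of_upsilon uH upsfin.
(* The equation for [u] holds off a null set of the line, which [ae_ln] carries to a null set of the
   half-line. *)
have wu : ae_eq mu (`]0%R, +oo[%classic : set R) w
    (fun y => - ((u (ln y) + derive1 u (ln y)) / y))%R.
  case: (ae_ln uf) => N [mN N0 uN]; exists N; split => // y /= /not_implyP[y0 wy].
  apply: uN => /= H; apply: wy; rewrite /= in_itv/= andbT in y0.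
  by rewrite H// /f lnK// mulNr opprK mulrAC divff ?mul1r// gt_eqF.
exists (u, m); last by split => //; exists ups.
split => //; exists ups; split => //.
- apply: lte_add_pinfty => //; rewrite -(pushes_toE Hups)//.
  apply: le_lt_trans nufin; apply: le_measure; rewrite ?inE//.
  exact: measurable_exp_of.
- exact/(pushes_to_limsup (measurable_sumH1 uH) mw wu Hups).
Qed.

End surjectivity.

Theorem lemma2p2 (R : realType) :
  bijection_mod (@eq_D R) (@eq_S0 R) (@set_D R) (@set_S0 R) (@transform R).
Proof.
split.
- exact: transform_total.
- exact: transform_well_defined.
- exact: transform_injective.
- exact: transform_surjective.
Qed.
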